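(* Let $\tau\ge1$ be an integer and let $H$ be the hypergraph representation of the network defined by $\{\mathcal{I}_j\}$. If some protocol for $\{\mathcal{I}_j\}$ generates $\tau$ secret keys, then $\mathsf{S}^{(\tau)}_{\mathrm{L}}(\{\mathcal{I}_j\})=\varrho_\tau(H)-\tau$.
   Context: Network model: $n$ clients $c_1,\dots,c_n$, finite sets $\mathcal{I}_1,\dots,\mathcal{I}_n$ of message indices (the family $\{\mathcal{I}_j\}$); messages $X_i$ ($i\in\bigcup_j\mathcal{I}_j$) i.i.d. uniform on a finite field $\mathbb{F}$ with $|\mathbb{F}|>n$; client $c_j$ holds $\{X_i:i\in\mathcal{I}_j\}$; $\underline{X}$ is the vector of all messages. A protocol: in each of $t$ rounds one client broadcasts to all an element of $\mathbb{F}$ that is a function of its own messages, the round index, and all previous broadcasts; $\mathbf{T}(\underline{X})\in\mathbb{F}^t$ collects the broadcasts. Linear protocol: each broadcast is an $\mathbb{F}$-linear combination of the transmitter's messages. A protocol generates $\tau$ secret keys if there are functions $\mathsf{k}_j$ with $K=\mathsf{k}_1(\{X_i:i\in\mathcal{I}_1\},\mathbf{T}(\underline{X}))$ such that (i) $\mathsf{k}_j(\{X_i:i\in\mathcal{I}_j\},\mathbf{T}(\underline{X}))=K$ a.s. for all $j$; (ii) $K$ is uniform on $\mathbb{F}^\tau$; (iii) $I(K;\mathbf{T}(\underline{X}))=0$. $\mathsf{S}^{(\tau)}_{\mathrm{L}}(\{\mathcal{I}_j\})$ is the minimum number of transmissions of a linear protocol generating $\tau$ secret keys. The hypergraph representation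 of $\{\mathcal{I}_j\}$ has vertex set $\{c_1,\dots,c_n\}$ and one hyperedge for each index $e\in\bigcup_j\mathcal{I}_j$ (repeated hyperedges allowed), with $c_j\in e$ iff $e\in\mathcal{I}_j$. A multigraph is induced by a hypergraph $H=(\mathcal{V},\mathcal{E})$ if its edge multiset decomposes as a disjoint union of edge sets of simple graphs $G_e=(e,E_e)$, $e\in\mathcal{E}$, each a connected simple graph on vertex set $e$. $H$ is inherently $\tau$-connected if every multigraph induced by $H$ contains at least $\tau$ edge-disjoint spanning trees. $\varrho_\tau(H)=\min\{|\mathcal{E}'|:\mathcal{E}'\subseteq\mathcal{E},\ (\mathcal{V},\mathcal{E}')\text{ inherently }\tau\text{-connected}\}$. *)

(* Defs.v *)
From HB Require Import structures.
From mathcomp Require Import all_boot all_order all_algebra all_field.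
Set Implicit Arguments.
Unset Strict Implicit.
Unset Printing Implicit Defensive.
Import GRing.Theory.

(* Message indices form a finite type M; client j holds the messages with
   indices in I j.  A realisation of all messages is x : {ffun M -> F};
   the messages are i.i.d. uniform, i.e. x is uniform on {ffun M -> F}, so
   probabilities are counts divided by #|F| ^ #|M|. *)

Definition agree_on (M : finType) (F : Type) (A : {set M}) (x y : M -> F) : Prop :=
  forall i, i \in A -> x i = y i.

(* A t-round protocol with schedule s (client s r broadcasts in round r);
   T x is the transcript.  Causality: the broadcast of round r is a function
   of the transmitter's messages and of the previous broadcasts. *)
Definition causal (n t : nat) (M : finType) (F : finFieldType)
    (I : 'I_n -> {set M}) (s : 'I_t -> 'I_n)
    (T : {ffun M -> F} -> {ffun 'I_t -> F}) : Prop :=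
  forall (r : 'I_t) (x y : {ffun M -> F}),
    agree_on (I (s r)) x y ->
    (forall r' : 'I_t, (r' < r)%N -> T x r' = T y r') ->
    T x r = T y r.

(* The transcript T allows generation of tau secret keys:
   (i) every client j computes K from its messages and T (a.s. = for every x,
       since every outcome has positive probability);
   (ii) K is uniform on F^tau;
   (iii) I(K;T) = 0, i.e. K and T are independent. *)
Definition generates_keys (n t : nat) (M : finType) (F : finFieldType)
    (I : 'I_n -> {set M}) (tau : nat)
    (T : {ffun M -> F} -> {ffun 'I_t -> F}) : Prop :=
  exists K : {ffun M -> F} -> {ffun 'I_tau -> F},
  [/\ forall (j : 'I_n) (x y : {ffun M -> F}),
        agree_on (I j) x y -> T x = T y -> K x = K y,
      forall k : {ffun 'I_tau -> F},
        (#|[set x | K x == k]| * #|F| ^ tau = #|F| ^ #|M|)%N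
    & forall (k : {ffun 'I_tau -> F}) (w : {ffun 'I_t -> F}),
        (#|[set x | (K x == k) && (T x == w)]| * #|F| ^ #|M|
         = #|[set x | K x == k]| * #|[set x | T x == w]|)%N ].

Definition protocol_generates (n : nat) (M : finType) (F : finFieldType)
    (I : 'I_n -> {set M}) (tau : nat) : Prop :=
  exists (t : nat) (s : 'I_t -> 'I_n) (T : {ffun M -> F} -> {ffun 'I_t -> F}),
    causal I s T /\ generates_keys I tau T.

Definition linear_transcript (t : nat) (M : finType) (F : finFieldType)
    (c : 'I_t -> M -> F) : {ffun M -> F} -> {ffun 'I_t -> F} :=
  fun x => [ffun r => (\sum_(i : M) c r i * x i)%R].

Definition linear_generates (n : nat) (M : finType) (F : finFieldType)
    (I : 'I_n -> {set M}) (tau : nat) (t : nat) : Prop :=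
  exists (s : 'I_t -> 'I_n) (c : 'I_t -> M -> F),
    (forall (r : 'I_t) (i : M), c r i != 0%R -> i \in I (s r)) /\
    generates_keys I tau (linear_transcript c).

(* Hyperedge e (for e : M) has vertex set [set j | e \in I j].
   A multigraph on the clients whose edges are labelled by hyperedges is a set
   D of triples (e,(u,v)) with u < v (an edge {u,v} of the simple graph G_e). *)
Definition medge (n : nat) (M : finType) := (M * ('I_n * 'I_n))%type.

Definition mg_rel (n : nat) (M : finType) (S : {set medge n M}) : rel 'I_n :=
  fun u v => [exists e : M, ((e, (u, v)) \in S) || ((e, (v, u)) \in S)].

Definition spanning_connected (n : nat) (M : finType) (S : {set medge n M}) : Prop :=
  forall u v : 'I_n, connect (mg_rel S) u v.

Definition spanning_tree (n : nat) (M : finType) (D T : {set medge n M}) : Prop :=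
  [/\ T \subset D, spanning_connected T & #|T| = n.-1].

(* D is a multigraph induced by the hypergraph (V, E'): D is the disjoint union
   over e in E' of connected simple graphs G_e on vertex set e. *)
Definition induced_by (n : nat) (M : finType) (I : 'I_n -> {set M})
    (E' : {set M}) (D : {set medge n M}) : Prop :=
  (forall (e : M) (u v : 'I_n), (e, (u, v)) \in D ->
     [/\ e \in E', (u < v)%N, e \in I u & e \in I v]) /\
  (forall e : M, e \in E' -> forall u v : 'I_n, e \in I u -> e \in I v ->
     connect (fun a b : 'I_n => ((e, (a, b)) \in D) || ((e, (b, a)) \in D)) u v).

Definition inherently_connected (n : nat) (M : finType) (I : 'I_n -> {set M})
    (tau : nat) (E' : {set M}) : Prop :=
  forall D : {set medge n M}, induced_by I E' D ->
    exists Ts : 'I_tau -> {set medge n M},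
      (forall i, spanning_tree D (Ts i)) /\
      (forall i j, i != j -> [disjoint Ts i & Ts j]).

Definition is_min (P : nat -> Prop) (m : nat) : Prop :=
  P m /\ forall k, P k -> (m <= k)%N.

Definition rho_pred (n : nat) (M : finType) (I : 'I_n -> {set M}) (tau : nat)
    (k : nat) : Prop :=
  exists E' : {set M}, inherently_connected I tau E' /\ #|E'| = k.

(* Main.v *)
Require Import Defs.
From HB Require Import structures.
From mathcomp Require Import all_boot all_order all_algebra all_field.
Set Implicit Arguments.
Unset Strict Implicit.
Unset Printing Implicit Defensive.
Import GRing.Theory.

(* By the tree-packing theorem of Nash-Williams and Tutte, [E'] is inherently
   [tau]-connected iff [\sum_(e in E') (|P_e| - 1) >= tau (|P| - 1)] for every
   partition [P] of the clients, where [P_e] is the set of blocks met by [e].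

   This inequality is necessary for key generation: giving every block its own
   copy of its messages cuts the decoupled inputs into disjoint boxes, one for
   each transcript, and a key known to all blocks makes each box
   at least [|F| ^ (tau (|P| - 1))] times larger than its diagonal.  For a linear protocol
   with [t] transmissions, setting all messages outside a suitable [E'] with at
   most [t + tau] elements to zero keeps [tau] keys, so [E'] satisfies it too.

   Conversely, the inequality gives numbers [d j] with
   [\sum_(j in S) d j + tau <= #|messages of E' known in S|] for all nonempty [S]
   and total [#|E'| - tau].  If client [j] makes [d j] transmissions in general
   position, every client recovers all of [E'], while [tau] dimensions remain
   independent of the transcript and serve as the keys. *)

(** * Packing disjoint bases *)

Section FamilySpan.
Variables (F : fieldType) (vT : vectType F) (E : finType) (v : E -> vT).
Implicit Types (A B : {set E}) (U : {vspace vT}).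

Definition fspan A : {vspace vT} := (\sum_(e in A) <[v e]>)%VS.

Lemma mem_fspan A e : e \in A -> v e \in fspan A.
Proof. by move=> eA; rewrite memvE /fspan; apply: (sumv_sup e). Qed.

Lemma fspan_subP A U : reflect (forall e, e \in A -> v e \in U) (fspan A <= U)%VS.
Proof.
apply: (iffP subv_sumP) => H e eA; have := H e eA; by rewrite -memvE.
Qed.

Lemma fspan_ind (P : vT -> Prop) A : P 0%R ->
  (forall x y, P x -> P y -> P (x + y)%R) ->
  (forall k e, e \in A -> P (k *: v e)%R) ->
  forall x, x \in fspan A -> P x.
Proof.
move=> P0 PD Pv x /memv_sumP[u uA ->]; apply: big_ind => // e eA.
by have /vlineP[k ->] := uA e eA; apply: Pv.
Qed.

Lemma fspanS A B : A \subset B -> (fspan A <= fspan B)%VS.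
Proof. by move=> /subsetP AB; apply/fspan_subP => e /AB/mem_fspan. Qed.

Lemma fspanU A B : fspan (A :|: B) = (fspan A + fspan B)%VS.
Proof.
apply/eqP; rewrite eqEsubv subv_add !fspanS ?subsetUl ?subsetUr // !andbT.
apply/fspan_subP => e; rewrite inE => /orP[] /mem_fspan.
  exact: (subvP (addvSl _ _)).
exact: (subvP (addvSr _ _)).
Qed.

Lemma fspan0 : fspan set0 = 0%VS.
Proof. by rewrite /fspan big_set0. Qed.

Lemma fspan1 e : fspan [set e] = <[v e]>%VS.
Proof. by rewrite /fspan big_set1. Qed.

Lemma dim_addv_line U x : \dim (U + <[x]>)%VS = (\dim U + (x \notin U))%N.
Proof.
case: (boolP (x \in U)) => xU /=.
  by rewrite addn0; congr (\dim _); apply/addv_idPl.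
have xn0 : x != 0%R by apply: contraNneq xU => ->; rewrite mem0v.
rewrite dimv_disjoint_sum ?dim_vline ?xn0 //.
apply/eqP; rewrite -subv0; apply/subvP => y; rewrite memv_cap memv0.
case/andP => yU /vlineP[k yk]; move: yU; rewrite {y}yk.
by have [->|k0] := eqVneq k 0%R; rewrite ?scale0r // rpredZeq (negbTE k0) (negbTE xU).
Qed.

Lemma dim_fspan A : (\dim (fspan A) <= #|A|)%N.
Proof.
rewrite -sum1_card; apply: leq_trans (dimv_leq_sum _ _ _) _.
by apply: leq_sum => e _; rewrite dim_vline; case: eqP.
Qed.

Definition indep A := \dim (fspan A) == #|A|.

Lemma indepU1 A e : e \notin A -> indep A -> v e \notin fspan A -> indep (e |: A).
Proof.
move=> eA /eqP iA veA.
by rewrite /indep setUC fspanU fspan1 dim_addv_line veA iA setUC cardsU1 eA /= addn1 // add1n.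
Qed.

(** For an inclusion-minimal [B] spanning [x], every [v g] has a nonzero coefficient in [x] and can
    be solved for: [B] acts as the fundamental circuit of [x]. *)
Lemma fspan_minimal A x : x \in fspan A ->
  exists B, [/\ B \subset A, x \in fspan B &
    forall g, g \in B -> v g \in (fspan (B :\ g) + <[x]>)%VS].
Proof.
move=> xA; have [B minB BA] := @minset_exists _ (fun B => x \in fspan B) A xA.
have [xB mB] := minsetP minB; exists B; split=> // g gB.
have xg : x \notin fspan (B :\ g).
  apply/negP => /mB; rewrite subD1set => /(_ isT) Bg.
  by move: gB; rewrite -Bg !inE eqxx.
move: xB; rewrite -{1}(setD1K gB) fspanU fspan1 => /memv_addP[_ /vlineP[k ->] [y yB xE]].
have k0 : k != 0%R by apply: contraNneq xg => k0; rewrite xE k0 scale0r add0r.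
have -> : v g = (- (k^-1 *: y) + k^-1 *: x)%R.
  by rewrite xE scalerDr scalerA mulVf // scale1r addrC addrK.
by apply: memv_add; rewrite ?rpredN rpredZ ?memv_line.
Qed.

Section BasePacking.
Variables (k N : nat) (D : {set E}).
Implicit Types (f : {ffun E -> option 'I_k}) (i : 'I_k).

Let cls f i : {set E} := [set e | f e == Some i].
Let unc f : {set E} := [set e in D | f e == None].

(** Coding the classes as fibres of one partial colouring makes them disjoint automatically. *)
Definition packing f :=
  [forall i, (cls f i \subset D) && indep (cls f i)].

Let recolor f e g i : {ffun E -> option 'I_k} :=
  [ffun a => if a == e then Some i else if a == g then None else f a].

Let exchange f f' :=
  packing f' && [exists e, exists g, exists i,
    [&& e \in unc f, f g == Some i & f' == recolor f e g i]].

Let cls_recolor f e g i i' : e \in unc f -> f g = Some i ->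
  cls (recolor f e g i) i' = if i' == i then e |: (cls f i :\ g) else cls f i'.
Proof.
rewrite inE => /andP[_ /eqP fe] fg; apply/setP => a.
rewrite /cls [LHS]inE ffunE; case: (i' =P i) => [->|/eqP ii]; rewrite !inE.
  case: (a =P e) => [_|_]; first by rewrite eqxx.
  by case: (a =P g) => //= ->.
case: (a =P e) => [->|_]; first by rewrite fe; apply/negbTE/eqP => -[ij]; rewrite ij eqxx in ii.
by case: (a =P g) => [->|//]; rewrite fg; apply/esym/negbTE/eqP => -[ij]; rewrite ij eqxx in ii.
Qed.

Hypothesis dimD : (\dim (fspan D) <= N)%N.
Hypothesis rankD : forall A, A \subset D ->
  (k * N <= #|D :\: A| + k * \dim (fspan A))%N.

(* Among the packings leaving fewest elements of [D] uncovered, let [A] collect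
   the elements that some sequence of exchanges from [f0] makes uncovered.  By
   maximality every class spans [A] from within [A], so the classes together have
   at least [#|D :\: A| + k * \dim (fspan A) >= k * N] elements. *)
Lemma base_packing : exists Ts : 'I_k -> {set E},
  [/\ forall i, Ts i \subset D, forall i, #|Ts i| = N,
      forall i, \dim (fspan (Ts i)) = N &
      forall i j, i != j -> [disjoint Ts i & Ts j]].
Proof.
have SomeN (i : 'I_k) : (Some i == None) = false by [].
have pack0 : packing [ffun=> None].
  apply/forallP => i; rewrite (_ : cls _ i = set0) ?sub0set /indep ?fspan0 ?dimv0 ?cards0 //.
  by apply/setP => e; rewrite !inE ffunE.
case: (@arg_minnP _ _ packing (fun f => #|unc f|) pack0) => f0 pf0 f0min.
have clsD f i : packing f -> cls f i \subset D by move=> /forallP/(_ i)/andP[].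
have clsI f i : packing f -> indep (cls f i) by move=> /forallP/(_ i)/andP[].
pose good f := packing f && (#|unc f| == #|unc f0|).
have exchange_good f f' : good f -> exchange f f' -> good f'.
  case/andP => pf /eqP uf /andP[pf' /existsP[e /existsP[g /existsP[i]]]].
  case/and3P => eu /eqP fg /eqP f'E; rewrite /good pf' /= -uf.
  have gD : g \in D by apply: (subsetP (clsD _ i pf)); rewrite inE fg.
  have fe : f e = None by move: eu; rewrite inE => /andP[_ /eqP].
  (* The uncovered set trades [e] for [g], so its size is kept. *)
  have -> : unc f' = g |: (unc f :\ e).
    apply/setP => a; rewrite !inE f'E ffunE.
    case: (a =P e) => [->|_] /=.
      rewrite SomeN andbF orbF; apply/esym/eqP => eg.
      by rewrite -eg fe in fg.
    by case: (a =P g) => [->|_]; rewrite ?gD.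
  rewrite cardsU1 (cardsD1 e (unc f)) eu [g \in _](_ : _ = false) //.
  by rewrite !inE fg; case: (g != e); case: (g \in D).
have reach_good f : connect exchange f0 f -> good f.
  case/connectP => s; elim/last_ind: s f => [|s g IH] f.
    by move=> _ ->; rewrite /good pf0 eqxx.
  rewrite rcons_path last_rcons => /andP[ps ex] ->.
  exact: exchange_good (IH _ ps erefl) ex.
pose A := [set a in D | [exists f, connect exchange f0 f && (f a == None)]].
(* An uncovered [a] outside the span of a class could join it, against the minimality of [f0]; every
   [g] in its circuit can be exchanged for [a], hence lies in [A]. *)
have span_unc f a i : connect exchange f0 f -> a \in unc f ->
    v a \in fspan (cls f i :&: A).
  move=> cf au; have /andP[pf /eqP uf] := reach_good _ cf.
  have [aD /eqP fa] : a \in D /\ f a == None by move: au; rewrite inE => /andP.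
  have acls : a \notin cls f i by rewrite inE fa.
  have vacls : v a \in fspan (cls f i).
    apply: contraT => nva.
    pose f' : {ffun E -> option 'I_k} := [ffun x => if x == a then Some i else f x].
    have clsf' j : cls f' j = if j == i then a |: cls f i else cls f j.
      apply/setP => x; rewrite [LHS]inE ffunE.
      case: (j =P i) => [->|/eqP ji]; rewrite !inE.
        by case: (x =P a) => [->|]; rewrite ?eqxx.
      by case: (x =P a) => [->|//]; rewrite fa; apply/negbTE/eqP => -[ij]; rewrite ij eqxx in ji.
    have pf' : packing f'.
      apply/forallP => j; rewrite clsf'; case: eqP => _; last by rewrite clsD ?clsI.
      rewrite indepU1 ?clsI // andbT; apply/subsetP => x; rewrite !inE.
      by case/orP => [/eqP->//|fx]; apply: (subsetP (clsD _ i pf)); rewrite inE.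
    have := f0min _ pf'; rewrite -uf leqNgt (_ : _ < _)%N //.
    apply: proper_card; apply/properP; split.
      by apply/subsetP => x; rewrite !inE ffunE; case: (x =P a) => // _ /andP[].
    by exists a => //; apply/negP; rewrite !inE ffunE eqxx => /andP[].
  have [B [Bcls vaB Bex]] := fspan_minimal vacls.
  apply: subvP vaB; apply: fspanS; apply/subsetP => g gB.
  have gcls := subsetP Bcls _ gB; rewrite inE gcls /=.
  have gD := subsetP (clsD _ i pf) _ gcls.
  have fg : f g = Some i by move: gcls; rewrite inE => /eqP.
  rewrite inE gD /=; apply/existsP; exists (recolor f a g i).
  have ga : g != a by apply: contraTneq gcls => ->.
  rewrite ffunE (negbTE ga) !eqxx andbT; apply: connect_trans cf (connect1 _).
  apply/andP; split; last first.
    by apply/existsP; exists a; apply/existsP; exists g; apply/existsP; exists i;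
      rewrite au fg !eqxx.
  apply/forallP => j; rewrite cls_recolor //; case: eqP => _; last by rewrite clsD ?clsI.
  apply/andP; split.
    rewrite subUset sub1set aD; exact: subset_trans (subD1set _ _) (clsD _ i pf).
  (* The new class has the size of the old one and spans it, since [v g] is recovered from [v a];
     hence it is independent. *)
  have cE : #|cls f i| = (#|cls f i :\ g|).+1 by rewrite (cardsD1 g) gcls.
  rewrite /indep eqn_leq dim_fspan cardsU1 in_setD1 (negbTE acls) andbF add1n -cE.
  rewrite -(eqP (clsI _ i pf)); apply: dimvS; apply/fspan_subP => x xc.
  have [->|xg] := eqVneq x g; last by apply: mem_fspan; apply/setU1P; right; apply/setD1P.
  apply: subvP (Bex _ gB); rewrite setUC fspanU fspan1 addvS //.
  by apply: fspanS; exact: setSD.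
have span_step f f' i : connect exchange f0 f -> exchange f f' ->
    fspan (cls f' i :&: A) = fspan (cls f i :&: A).
  move=> cf ex; have cf' := connect_trans cf (connect1 ex).
  case/andP: ex => pf' /existsP[e /existsP[g /existsP[j]]].
  case/and3P => eu /eqP fg /eqP f'E.
  have clsE := cls_recolor i eu fg; rewrite -f'E in clsE.
  case: (i =P j) clsE => [<-|_ -> //] clsE.
  have eg : g != e.
    by apply: contraTneq eu => <-; rewrite inE fg; apply/negP => /andP[].
  (* [e] is uncovered in [f] and [g] in [f'], so [span_unc] gives one inclusion from each
     packing. *)
  have gu : g \in unc f'.
    rewrite inE f'E ffunE (negbTE eg) !eqxx andbT.
    have /andP[pf _] := reach_good _ cf.
    by apply: (subsetP (clsD _ j pf)); rewrite inE fg.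
  apply/eqP; rewrite eqEsubv; apply/andP; split; apply/fspan_subP => x.
    rewrite inE clsE => /andP[/setU1P[-> _|xc xA]]; first exact: span_unc.
    by apply: mem_fspan; rewrite inE xA andbT; case/setD1P: xc.
  rewrite inE => /andP[xc xA]; have [->|xg] := eqVneq x g; first exact: span_unc.
  by apply: mem_fspan; rewrite inE xA clsE andbT; apply/setU1P; right; apply/setD1P.
have span_inv f i : connect exchange f0 f ->
    fspan (cls f i :&: A) = fspan (cls f0 i :&: A).
  case/connectP => s; elim/last_ind: s f => [|s g IH] f; first by move=> _ ->.
  rewrite rcons_path last_rcons => /andP[ps ex] ->.
  rewrite -(IH _ ps erefl); apply: span_step ex; by apply/connectP; exists s.
have spanA i : (fspan A <= fspan (cls f0 i :&: A))%VS.
  apply/fspan_subP => a; rewrite inE => /andP[aD /existsP[f /andP[cf fa]]].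
  by rewrite -(span_inv _ i cf) span_unc // inE aD.
have AD : A \subset D by apply/subsetP => a; rewrite inE => /andP[].
have card_cls i : (#|cls f0 i| <= N)%N.
  rewrite -(eqP (clsI _ i pf0)); apply: leq_trans dimD.
  by apply: dimvS; apply: fspanS; exact: clsD.
have card_clsA i : (\dim (fspan A) + #|cls f0 i :\: A| <= #|cls f0 i|)%N.
  rewrite -(cardsID A (cls f0 i)) leq_add2r.
  by apply: leq_trans (dimvS (spanA i)) (dim_fspan _).
(* Elements uncovered by [f0] itself are in [A] through the empty exchange sequence, so [f0] colours
   all of [D :\: A]. *)
have covDA : (#|D :\: A| <= \sum_i #|cls f0 i :\: A|)%N.
  rewrite -sum1_card; have -> : (\sum_i #|cls f0 i :\: A| =
     \sum_(e : E) \sum_(i | e \in cls f0 i :\: A) 1)%N.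
    by rewrite (exchange_big_dep predT) //=; apply: eq_bigr => i _; rewrite sum1_card.
  rewrite big_mkcond; apply: leq_sum => e _; case: ifP => //.
  rewrite inE => /andP[eA eD]; case fe: (f0 e) => [i|].
    by rewrite (bigD1 i) //= !inE fe eqxx andbT; move: eA; rewrite inE.
  by case/negP: eA; rewrite inE eD; apply/existsP; exists f0; rewrite connect0 fe.
have sumge : (k * N <= \sum_i #|cls f0 i|)%N.
  apply: leq_trans (rankD AD) _; rewrite addnC.
  apply: leq_trans (_ : \sum_i (\dim (fspan A) + #|cls f0 i :\: A|) <= _)%N; last first.
    by apply: leq_sum => i _; exact: card_clsA.
  by rewrite big_split /= sum_nat_const card_ord leq_add2l.
have cardE i : #|cls f0 i| = N.
  apply/eqP; rewrite eqn_leq card_cls /= leqNgt; apply/negP => ltN.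
  move: sumge; rewrite leqNgt => /negP[].
  rewrite -[k in X in (_ < X)%N]card_ord -sum_nat_const.
  rewrite (bigD1 i) //= [in X in (_ < X)%N](bigD1 i) //= -addSn leq_add //.
  by apply: leq_sum => j _.
exists (cls f0); split=> // [i|i|i j ij]; first exact: clsD.
  by rewrite (eqP (clsI _ i pf0)).
rewrite -setI_eq0; apply/eqP/setP => e; rewrite !inE.
by apply/negP => /andP[/eqP-> /eqP[]] ji; rewrite ji eqxx in ij.
Qed.
End BasePacking.

End FamilySpan.

(** * The graphic matroid *)

Section CoordinateSpace.
Variables (F : fieldType) (T : finType).
Implicit Types (A B : {set T}) (x : {ffun T -> F^o}).
Local Open Scope ring_scope.

Definition delta (i : T) : {ffun T -> F^o} := [ffun j => (i == j)%:R].

Definition coordsp A := fspan delta A.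

Lemma ffun_sum_delta x : x = \sum_i x i *: delta i.
Proof.
apply/ffunP => j; rewrite sum_ffunE (bigD1 j) //= !ffunE eqxx big1 => [|i ij].
  by rewrite addr0 /GRing.scale /= mulr1.
by rewrite !ffunE (negbTE ij) scaler0.
Qed.

Lemma coordspP A x : reflect (forall i, i \notin A -> x i = 0) (x \in coordsp A).
Proof.
apply: (iffP idP) => [xA i iA|x0].
  move: x xA; apply: fspan_ind => [|x y x0 y0|k e eA]; first by rewrite ffunE.
    by rewrite ffunE x0 y0 addr0.
  rewrite !ffunE (_ : e == i = false) ?scaler0 //.
  by apply: contraNF iA => /eqP <-.
rewrite [x]ffun_sum_delta; apply: memv_suml => i _.
have [iA|iA] := boolP (i \in A); last by rewrite x0 // scale0r mem0v.
by rewrite rpredZ // mem_fspan.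
Qed.

Lemma indep_delta A : indep delta A.
Proof.
have [m] := ubnP #|A|; elim: m A => // m IH A Am.
have [->|[e eA]] := set_0Vmem A; first by rewrite /indep fspan0 dimv0 cards0.
rewrite -(setD1K eA) indepU1 ?setD11 //.
  by apply: IH; rewrite (cardsD1 e) eA in Am.
apply/negP => /coordspP/(_ e); rewrite setD11 => /(_ isT)/eqP.
by rewrite ffunE eqxx oner_eq0.
Qed.

Lemma dim_coordsp A : \dim (coordsp A) = #|A|.
Proof. exact/eqP/indep_delta. Qed.

Lemma coordspT : coordsp setT = fullv.
Proof.
apply/eqP; rewrite eqEsubv subvf /=; apply/subvP => x _.
by apply/coordspP => i; rewrite inE.
Qed.

Lemma dim_ffunv : \dim (fullv : {vspace {ffun T -> F^o}}) = #|T|.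
Proof. by rewrite -coordspT dim_coordsp cardsT. Qed.

End CoordinateSpace.

Arguments delta {F T} i.

Section Multigraph.
Variables (F : fieldType) (n : nat) (M : finType).
Implicit Types (S : {set medge n M}) (p : 'I_n -> 'I_n).
Local Open Scope ring_scope.

(** Oriented incidence vector of the edge once the fibres of [p] are contracted; an edge inside a
    fibre becomes zero, and [p = id] gives the graphic matroid. *)
Definition edge_vec p (x : medge n M) : {ffun 'I_n -> F^o} :=
  delta (p x.2.1) - delta (p x.2.2).

Lemma mg_rel_sym S : connect_sym (mg_rel S).
Proof.
apply: sym_connect_sym => u v; apply/existsP/existsP => -[e] H;
  by exists e; rewrite orbC.
Qed.

Lemma connect_edge_vec S p u v : connect (mg_rel S) u v ->
  delta (p u) - delta (p v) \in fspan (edge_vec p) S.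
Proof.
case/connectP => s; elim: s u => [u _ ->|w s IH u]; first by rewrite subrr mem0v.
move=> /= /andP[/existsP[e uw] ws] vE.
rewrite -(subrKA (delta (p w))) rpredD //; last exact: IH ws vE.
case/orP: uw => /(mem_fspan (edge_vec p)) // wu.
by rewrite -opprB rpredN.
Qed.

Definition crossing p S := [set x in S | p x.2.1 != p x.2.2].

(** The crossing edge vectors together with a single [delta (p a)] span every [delta (p u)] with [u]
    in [A]. *)
Lemma card_crossing S p (A : {set 'I_n}) :
  (forall u v, u \in A -> v \in A -> connect (mg_rel S) u v) ->
  (#|p @: A| <= #|crossing p S|.+1)%N.
Proof.
move=> conA; have [->|[a aA]] := set_0Vmem A; first by rewrite imset0 cards0.
rewrite -(@dim_coordsp F).
apply: leq_trans
  (_ : \dim (fspan (edge_vec p) (crossing p S) + <[delta (p a)]>) <= _)%N; last first.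
  rewrite dim_addv_line -addn1 leq_add ?dim_fspan //; by case: (_ \notin _).
apply: dimvS; apply/fspan_subP => _ /imsetP[u uA ->].
rewrite -[delta _](subrK (delta (p a))) memv_add ?memv_line //.
apply: subvP (connect_edge_vec p (conA _ _ uA aA)); apply/fspan_subP => x xS.
have [pE|pN] := eqVneq (p x.2.1) (p x.2.2); last by apply: mem_fspan; rewrite inE xS.
by rewrite /edge_vec pE subrr mem0v.
Qed.

(** Modulo the edge vectors, each [delta u] equals the [delta] of the root of its component. *)
Lemma rank_components S :
  (n <= #|[set fingraph.root (mg_rel S) u | u in setT]| + \dim (fspan (edge_vec id) S))%N.
Proof.
rewrite -(@dim_coordsp F).
set C := [set _ | _ in _].
apply: leq_trans (_ : \dim (coordsp F C + fspan (edge_vec id) S) <= _)%N; last first.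
  exact: (dimv_add_leqif _ _).
rewrite -{1}[n]card_ord -(dim_ffunv F); apply: dimvS; rewrite -coordspT.
apply/fspan_subP => u _; rewrite -[delta u](subrK (delta (fingraph.root (mg_rel S) u))) addrC.
apply: memv_add; first by apply: mem_fspan; apply: imset_f.
exact: (connect_edge_vec id (connect_root _ u)).
Qed.

(** The component sum is a linear functional, and it kills each edge vector because both ends lie in
    the same component. *)
Lemma component_sum S u x : x \in fspan (edge_vec id) S ->
  \sum_(w | connect (mg_rel S) u w) x w = 0.
Proof.
move: x; apply: fspan_ind => [|x y x0 y0|k [e [a b]] eS].
- by rewrite big1 // => w _; rewrite ffunE.
- rewrite (eq_bigr (fun w => x w + y w)) => [|w _]; last by rewrite ffunE.
  by rewrite big_split /= x0 y0 addr0.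
have ab : connect (mg_rel S) u a = connect (mg_rel S) u b.
  apply: same_connect_r; first exact: mg_rel_sym.
  by apply: connect1; apply/existsP; exists e; rewrite eS.
have sum_delta c : \sum_(w | connect (mg_rel S) u w) (delta c : {ffun 'I_n -> F^o}) w =
    (connect (mg_rel S) u c)%:R.
  case: (boolP (connect _ u c)) => cc.
    rewrite (bigD1 c) //= ffunE eqxx big1 ?addr0 // => w /andP[_ wc].
    by rewrite ffunE eq_sym (negbTE wc).
  rewrite big1 // => w uw; rewrite ffunE; case: eqP => // cw.
  by rewrite cw uw in cc.
transitivity (k * (\sum_(w | connect (mg_rel S) u w) (delta a : {ffun 'I_n -> F^o}) w
   - \sum_(w | connect (mg_rel S) u w) (delta b : {ffun 'I_n -> F^o}) w)).
  by rewrite -sumrB mulr_sumr; apply: eq_bigr => w _; rewrite !ffunE.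
by rewrite !sum_delta ab subrr mulr0.
Qed.

(** Were [u] and [v] disconnected, component sums would show that [delta v] and [delta u] raise the
    rank by two, to [n + 1]. *)
Lemma full_rank_connected S :
  \dim (fspan (edge_vec id) S) = n.-1 -> spanning_connected S.
Proof.
move=> dS u v; apply: contraT => nuv.
have vS : delta v \notin fspan (edge_vec id) S.
  apply/negP => /(component_sum v)/eqP.
  rewrite (bigD1 v) ?connect0 //= ffunE eqxx big1 ?addr0 ?oner_eq0 //.
  by move=> w /andP[_ wv]; rewrite ffunE eq_sym (negbTE wv).
have uS : delta u \notin (fspan (edge_vec id) S + <[delta v]>)%VS.
  apply/negP => /memv_addP[x xS [_ /vlineP[k ->] uE]].
  have /eqP := component_sum u xS.
  rewrite (_ : x = delta u - k *: delta v); last by rewrite uE addrK.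
  rewrite (bigD1 u) ?connect0 //= big1 => [|w /andP[uw wu]].
    rewrite !ffunE eqxx (_ : v == u = false) ?scaler0 ?subr0 ?addr0 ?oner_eq0 //.
    by apply: contraNF nuv => /eqP ->.
  rewrite !ffunE eq_sym (negbTE wu) (_ : v == w = false) ?scaler0 ?subr0 //.
  by apply: contraNF nuv => /eqP ->.
have := dimvS (subvf (fspan (edge_vec id) S + <[delta v]> + <[delta u]>)).
rewrite dim_ffunv card_ord 2!dim_addv_line uS vS dS.
by case: n u {v nuv vS uS dS} => [[]//|m] u; rewrite /= addn1 addn1 ltnn.
Qed.

End Multigraph.

(** * Partition connectivity *)

Lemma sum_card_disjoint (J X : finType) (A : J -> {set X}) (B : {set X}) :
  (forall i, A i \subset B) -> (forall i j, i != j -> [disjoint A i & A j]) ->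
  \sum_i #|A i| <= #|B|.
Proof.
move=> AB disA; rewrite -sum1_card.
have -> : \sum_i #|A i| = \sum_(x : X) \sum_(i | x \in A i) 1.
  by rewrite (exchange_big_dep predT) //=; apply: eq_bigr => i _; rewrite sum1_card.
rewrite [leqRHS]big_mkcond; apply: leq_sum => x _.
have [i xi|A0] := pickP (fun i => x \in A i); last by rewrite big_pred0.
rewrite (subsetP (AB i)) // (big_pred1 i) // => j; apply/idP/eqP => [xj|->//].
by apply/eqP; apply: contraLR xj => ji; rewrite (disjointFl (disA _ _ ji)).
Qed.

Section PartitionConnected.
Variables (n : nat) (M : finType) (I : 'I_n -> {set M}) (tau : nat).

Definition clients (e : M) : {set 'I_n} := [set j | e \in I j].

(* [p] encodes the partition of the clients into its fibres; an induced
   multigraph has at least [\sum_e (#|p @: e| - 1)] edges joining different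
   blocks, and [tau] disjoint spanning trees need [tau * (#|p @: setT| - 1)]. *)
Definition partition_connected (E' : {set M}) :=
  [forall p : {ffun 'I_n -> 'I_n},
    tau * #|p @: setT| + #|E'| <= \sum_(e in E') #|p @: clients e| + tau].

Lemma partition_connectedP E' (p : 'I_n -> 'I_n) : partition_connected E' ->
  tau * #|p @: setT| + #|E'| <= \sum_(e in E') #|p @: clients e| + tau.
Proof.
move=> /forallP/(_ [ffun j => p j]); have pE (A : {set 'I_n}) : [ffun j => p j] @: A = p @: A.
  by apply: eq_imset => j; rewrite ffunE.
by rewrite pE (eq_bigr (fun e => #|p @: clients e|)) // => e _; rewrite pE.
Qed.

(** Each [G_e] stays connected after contraction, so it has at least [#|p @: clients e| - 1]
    crossing edges. *)
Lemma crossing_induced E' (D : {set medge n M}) p : induced_by I E' D ->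
  \sum_(e in E') #|p @: clients e| <= #|crossing p D| + #|E'|.
Proof.
move=> [DE Dcon]; pose De e := [set x in D | x.1 == e].
apply: leq_trans (_ : \sum_(e in E') #|crossing p (De e)|.+1 <= _).
  apply: leq_sum => e eE; apply: (card_crossing rat) => u v.
  rewrite !inE => eu ev; apply: connect_sub (Dcon e eE u v eu ev) => a b ab.
  by apply: connect1; apply/existsP; exists e; rewrite !inE eqxx !andbT.
under eq_bigr do rewrite -addn1.
rewrite big_split /= sum1_card leq_add2r -[leqRHS]sum1_card.
rewrite (partition_big fst (mem E')) /=; last first.
  by move=> [e [u v]]; rewrite inE => /andP[/DE[]].
apply: leq_sum => e _; rewrite sum1_card; apply: subset_leq_card.
apply/subsetP => x; rewrite inE => /andP[]; rewrite inE => /andP[xD xe] px.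
by rewrite unfold_in /= inE xD px xe.
Qed.

(** [base_packing] is applied to the graphic matroid of [D] over [rat]; its rank condition for [A]
    comes from the partition inequality for the components of [A]. *)
Lemma partition_connected_inherently (E' : {set M}) :
  partition_connected E' -> inherently_connected I tau E'.
Proof.
move=> pcE D indD; have [DE _] := indD.
have [|A AD|Ts [TD Tn Tdim Tdis]] := @base_packing rat _ _ (edge_vec rat id) tau n.-1 D.
- case: (posnP n) => [n0|n0].
    by rewrite (leq_trans (dimvS (subvf _))) // dim_ffunv card_ord {2}n0 n0.
  pose u := Ordinal n0.
  have uD : delta u \notin fspan (edge_vec rat id) D.
    apply/negP => /(component_sum u)/eqP.
    rewrite (bigD1 u) ?connect0 //= ffunE eqxx big1 ?addr0 ?oner_eq0 //.
    by move=> w /andP[_ wv]; rewrite ffunE eq_sym (negbTE wv).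
  have := dimvS (subvf (fspan (edge_vec rat id) D + <[delta u]>)%VS).
  by rewrite dim_ffunv card_ord dim_addv_line uD addn1 => ltn; rewrite -ltnS prednK.
- pose p := fingraph.root (mg_rel A).
  have crossA : crossing p D \subset D :\: A.
    apply/subsetP => x; rewrite !inE => /andP[-> px]; rewrite andbT.
    apply: contra px => xA; rewrite (root_connect (mg_rel_sym A)).
    by apply: connect1; apply/existsP; exists x.1; case: x xA => e [a b] /= ->.
  have h1 := partition_connectedP p pcE; have h2 := crossing_induced p indD.
  have h3 := subset_leq_card crossA; have h4 := rank_components rat A.
  have h5 : tau * n <= tau * #|p @: setT| + tau * \dim (fspan (edge_vec rat id) A).
    by rewrite -mulnDr leq_mul2l h4 orbT.
  have h6 : tau * #|p @: setT| <= #|D :\: A| + tau.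
    rewrite -(leq_add2r #|E'|); apply: leq_trans h1 _.
    by rewrite addnAC leq_add2r; apply: leq_trans h2 _; rewrite leq_add2r.
  rewrite -subn1 mulnBr muln1 leq_subLR; apply: leq_trans h5 _.
  by rewrite addnA leq_add2r addnC.
- exists Ts; split=> // i; split=> //; exact: full_rank_connected.
Qed.

(** For each partition a single induced multigraph is tested, one with the fewest edges between
    blocks. *)
Lemma inherently_partition_connected (E' : {set M}) :
  (forall e, e \in E' -> clients e != set0) ->
  inherently_connected I tau E' -> partition_connected E'.
Proof.
move=> E0 inh; apply/forallP => p.
(* Inside [e], clients of the same block are all joined, and the least client of [e] is joined to
   the least client of [e] in every other block; least clients fit the orientation [u < v]. *)
pose minc e u := [forall w, (e \in I w) ==> (u <= w)%N].
pose minb e v := [forall w, (e \in I w) && (p w == p v) ==> (v <= w)%N].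
pose edge e (u v : 'I_n) := [&& e \in E', (u < v)%N, e \in I u, e \in I v &
   (p u == p v) || (minc e u && minb e v)].
pose D := [set x : medge n M | edge x.1 x.2.1 x.2.2].
have indD : induced_by I E' D.
  split=> [e u v|e eE u v eu ev].
    by rewrite inE => /and5P[].
  set r := (fun _ _ => _).
  have rsym : connect_sym r.
    by apply: sym_connect_sym => a b; rewrite /r orbC.
  have min_ex (P : pred 'I_n) a : P a -> exists2 b, P b & forall c, P c -> b <= c.
    by move=> Pa; case: (arg_minnP (fun c : 'I_n => val c) Pa) => b Pb bmin; exists b.
  have [m em mmin] := min_ex (fun w => e \in I w) u eu.
  have mm : minc e m by apply/forallP => w; apply/implyP; apply: mmin.
  have same a b : e \in I a -> e \in I b -> p a = p b -> a < b -> connect r a b.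
    move=> ea eb pab ab; apply: connect1; rewrite /r !inE /edge /= eE ab ea eb.
    by rewrite pab eqxx.
  have same' a b : e \in I a -> e \in I b -> p a = p b -> connect r a b.
    move=> ea eb pab; case: (ltngtP a b) => [ab|ab|/val_inj->]; last exact: connect0.
      exact: same.
    by rewrite rsym; apply: same.
  have to_m w : e \in I w -> connect r w m.
    move=> ew; have [b /andP[eb /eqP pb] bmin] :=
      min_ex (fun c => (e \in I c) && (p c == p w)) w (introT andP (conj ew (eqxx _))).
    apply: connect_trans (same' _ _ ew eb (esym pb)) _.
    have [pbm|pbm] := eqVneq (p b) (p m); first exact: same'.
    rewrite rsym; apply: connect1; rewrite /r !inE /edge /= eE em eb mm /=.
    rewrite [X in X || _](_ : _ = true) // ltn_neqAle mmin // andbT.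
    rewrite (_ : (m != b :> nat)) /=; last first.
      by apply: contraNneq pbm => /val_inj ->.
    apply/orP; right; apply/forallP => c; apply/implyP; rewrite pb; exact: bmin.
  by rewrite (connect_trans (to_m _ eu)) // rsym to_m.
have [Ts [treeT disT]] := inh D indD.
have crossT i : #|p @: setT| <= #|crossing p (Ts i)|.+1.
  have [_ conT _] := treeT i; apply: (card_crossing rat) => u v _ _; exact: conT.
have sumT : \sum_i #|crossing p (Ts i)| <= #|crossing p D|.
  apply: sum_card_disjoint => [i|i j ij].
    apply/subsetP => x; rewrite !inE => /andP[xT ->]; rewrite andbT.
    by have [/subsetP/(_ x xT)] := treeT i; rewrite inE.
  apply: disjointW (disT i j ij); by apply/subsetP => x; rewrite inE => /andP[].
(* A crossing edge of [e] starts at the least client [m'] and is determined by the block of its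
   other end, which is not the block of [m']. *)
have crossD : #|crossing p D| + #|E'| <= \sum_(e in E') #|p @: clients e|.
  have -> : #|crossing p D| = \sum_(e in E') #|[set x in crossing p D | x.1 == e]|.
    rewrite -sum1_card (partition_big fst (mem E')) /=; last first.
      by move=> x; rewrite !inE => /andP[/and5P[]].
    apply: eq_bigr => e _; rewrite -sum1_card; apply: eq_bigl => x.
    by rewrite [RHS]inE.
  rewrite -[X in _ + X <= _]sum1_card -big_split /=; apply: leq_sum => e eE.
  have [m] := set0Pn _ (E0 e eE); rewrite inE => em0.
  case: (@arg_minnP _ m (fun c => e \in I c) val em0) => m' em' m'min {m em0}.
  rewrite (cardsD1 (p m')) imset_f ?inE // addnC leq_add2l.
  set X := [set x in _ | _].
  have XP x : x \in X -> [/\ x.1 = e, x.2.1 = m', e \in I x.2.2, p x.2.2 != p m' & minb e x.2.2].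
    rewrite !inE => /andP[/andP[/and5P[_ xlt]]]; case: x xlt => [e' [u v]] /= uv eu ev.
    move=> H puv /eqP e'E; subst e'; move: H; rewrite (negbTE puv) /= => /andP[mu mv].
    have um : u = m'.
      by apply/val_inj/eqP; rewrite eqn_leq (implyP (forallP mu m')) // m'min.
    by rewrite -um eq_sym.
  have injX : {in X &, injective (fun x : medge n M => p x.2.2)}.
    move=> [e1 [u1 v1]] [e2 [u2 v2]] /XP[/= -> -> ev1 _ m1] /XP[/= -> -> ev2 _ m2] pE.
    congr (_, (_, _)); apply/val_inj/eqP; rewrite eqn_leq.
    by rewrite (implyP (forallP m1 v2)) ?(implyP (forallP m2 v1)) // ?ev1 ?ev2 pE eqxx.
  rewrite -(card_in_imset injX); apply: subset_leq_card; apply/subsetP => _ /imsetP[x xX ->].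
  by have [_ _ ex px _] := XP x xX; rewrite !inE px imset_f ?inE.
apply: leq_trans (_ : #|crossing p D| + #|E'| + tau <= _); last by rewrite leq_add2r.
rewrite addnAC leq_add2r.
apply: leq_trans (_ : \sum_(i < tau) #|crossing p (Ts i)|.+1 <= _).
  by rewrite -{1}(card_ord tau) -sum_nat_const; apply: leq_sum => i _; apply: crossT.
under eq_bigr do rewrite -addn1.
by rewrite big_split /= sum1_card card_ord leq_add2r.
Qed.

End PartitionConnected.

(** * Decoupling the blocks of a partition *)

Lemma card_ffun_prod (J Z : finType) (A : J -> {set Z}) :
  #|[set y : {ffun J -> Z} | [forall b, y b \in A b]]| = \prod_b #|A b|.
Proof.
transitivity (foldr muln 1 [seq #|A b| | b : J]); last first.
  by rewrite foldrE big_map big_enum.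
rewrite -[RHS](card_family (fun b => mem (A b))); apply: eq_card => y.
by rewrite inE; apply/forallP/familyP.
Qed.

Lemma nat_AGM (J : finType) (a : J -> nat) :
  #|J| ^ #|J| * \prod_i a i <= (\sum_i a i) ^ #|J|.
Proof.
have := @Num.Theory.leif_AGM_scaled int J predT (fun i => (a i)%:R%R).
case=> [i _|]; first by rewrite Num.Theory.mulrn_wge0 ?Num.Theory.ler0n.
move=> + _; rewrite -natr_sum -natrX.
under eq_bigr do rewrite -mulrnA.
rewrite -natr_prod Num.Theory.ler_nat big_split /= prod_nat_const.
by rewrite mulnC.
Qed.

Section Supported.
Variables (F : finFieldType) (M : finType).
Local Open Scope ring_scope.

Definition supported (A : {set M}) : {set {ffun M -> F}} :=
  [set x : {ffun M -> F} | [forall i, (i \notin A) ==> (x i == 0)]].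

Lemma supportedP (A : {set M}) (x : {ffun M -> F}) :
  reflect (forall i, i \notin A -> x i = 0) (x \in supported A).
Proof.
rewrite inE; apply: (iffP forallP) => [H i iA|H i].
  by apply/eqP; exact: implyP (H i) iA.
by apply/implyP => /H ->.
Qed.

Lemma card_supported (A : {set M}) : #|supported A| = (#|F| ^ #|A|)%N.
Proof.
rewrite -(dim_coordsp F A).
rewrite -[RHS](@card_vspace F {ffun M -> F} (Vector.class {ffun M -> F^o})).
by apply: eq_card => x; apply/supportedP/coordspP.
Qed.

Lemma supportedT (x : {ffun M -> F}) : x \in supported setT.
Proof. by apply/supportedP => i; rewrite inE. Qed.

End Supported.

(* The clients of a block [p^-1 b] are merged into one party, and each party is
   given its own independent copy of the messages it knows.  By causality such
   an input is consistent with at most one transcript, so the sets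
   [consistent b w] cut disjoint boxes out of the product of all inputs; the
   genuine inputs sit in these boxes as the diagonal. *)
Section Decoupling.
Variables (n t : nat) (M : finType) (F : finFieldType) (I : 'I_n -> {set M}).
Variables (s : 'I_t -> 'I_n) (T : {ffun M -> F} -> {ffun 'I_t -> F}).
Variables (E' : {set M}) (p : 'I_n -> 'I_n).
Hypothesis causalT : causal I s T.

Definition block_msgs b : {set M} := [set e in E' | b \in p @: clients I e].

Definition restrict b (x : {ffun M -> F}) : {ffun M -> F} :=
  [ffun i => if i \in block_msgs b then x i else 0%R].

(** Block [b] holding [z] acts as [w] prescribes. The witness [x] appears because [T] takes complete
    inputs only; by causality every such [x] gives the same broadcast. *)
Definition consistent b (w : {ffun 'I_t -> F}) : {set {ffun M -> F}} :=
  [set z in supported F (block_msgs b) |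
    [forall r, (p (s r) == b) ==> [exists x : {ffun M -> F},
      [&& [forall i in I (s r), x i == z i], T x r == w r &
          [forall r' : 'I_t, (r' < r) ==> (T x r' == w r')]]]]].

Lemma sum_block_msgs : \sum_b #|block_msgs b| = \sum_(e in E') #|p @: clients I e|.
Proof.
have bE b : #|block_msgs b| = \sum_(e in E' | b \in p @: clients I e) 1.
  by rewrite -sum1_card; apply: eq_bigl => e; rewrite inE.
rewrite (eq_bigr _ (fun b _ => bE b)) (exchange_big_dep (mem E')) //=; last first.
  by move=> b e _ /andP[].
by apply: eq_bigr => e eE; rewrite -sum1_card; apply: eq_bigl => b; rewrite eE.
Qed.

Lemma restrict_agree x y j : x \in supported F E' -> y \in supported F E' ->
  restrict (p j) x = restrict (p j) y -> agree_on (I j) x y.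
Proof.
move=> /supportedP xE /supportedP yE /ffunP xy i ij; have := xy i; rewrite !ffunE inE.
have [iE|iE] := boolP (i \in E'); last by rewrite xE ?yE.
by rewrite imset_f ?inE.
Qed.

Lemma restrict_consistent x b : x \in supported F E' -> restrict b x \in consistent b (T x).
Proof.
move=> /supportedP xE; rewrite inE; apply/andP; split.
  by apply/supportedP => i ib; rewrite ffunE (negbTE ib).
apply/forallP => r; apply/implyP => /eqP pb; apply/existsP; exists x.
rewrite eqxx /=; apply/andP; split; last by apply/forallP => r'; rewrite eqxx implybT.
apply/forallP => i; apply/implyP => ij; rewrite ffunE inE.
have [iE|iE] := boolP (i \in E'); last by rewrite xE.
by rewrite -pb imset_f ?inE.
Qed.

Lemma restrict_inj : (forall e, e \in E' -> clients I e != set0) ->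
  {in supported F E' &, forall x y, (forall b, restrict b x = restrict b y) -> x = y}.
Proof.
move=> E0 x y xE yE xy; apply/ffunP => i.
have [/E0/set0Pn[j]|iE] := boolP (i \in E').
  by rewrite inE => ij; exact: restrict_agree (xy (p j)) i ij.
by rewrite (supportedP _ _ xE) // (supportedP _ _ yE).
Qed.

(** Transcripts partition the genuine inputs, while the boxes [fam w] are disjoint in [all]; summing
    the hypothesis over [w] compares the totals. *)
Lemma decoupling c :
  (forall w, c * #|[set x in supported F E' | T x == w]| <= \prod_b #|consistent b w|) ->
  c * #|F| ^ #|E'| <= #|F| ^ \sum_(e in E') #|p @: clients I e|.
Proof.
move=> H.
pose fam w := [set y : {ffun 'I_n -> {ffun M -> F}} | [forall b, y b \in consistent b w]].
pose all := [set y : {ffun 'I_n -> {ffun M -> F}} | [forall b, y b \in supported F (block_msgs b)]].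
have : \sum_w #|fam w| <= #|all|.
  apply: sum_card_disjoint => [w|w w' ww'].
    apply/subsetP => y; rewrite !inE => /forallP yw; apply/forallP => b.
    by have := yw b; rewrite inE => /andP[].
  rewrite -setI_eq0; apply: contraNT ww' => /set0Pn[y].
  rewrite !inE => /andP[/forallP yw /forallP yw'].
  (* Induction on rounds: if [w] and [w'] agree before round [r], the transmitter's copy in [y] and
     causality determine round [r]. *)
  suff wr m (r : 'I_t) : r < m -> w r = w' r by apply/eqP/ffunP => r; exact: (wr r.+1).
  elim: m r => // m IH r rm.
  have := yw (p (s r)); rewrite inE => /andP[_ /forallP/(_ r)]; rewrite eqxx /=.
  case/existsP => x /and3P[/forallP xz /eqP <- /forallP xw].
  have := yw' (p (s r)); rewrite inE => /andP[_ /forallP/(_ r)]; rewrite eqxx /=.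
  case/existsP => x' /and3P[/forallP xz' /eqP <- /forallP xw'].
  apply: causalT => [i ij|r' rr'].
    by rewrite (eqP (implyP (xz i) ij)) (eqP (implyP (xz' i) ij)).
  rewrite (eqP (implyP (xw r') rr')) (eqP (implyP (xw' r') rr')).
  by apply: IH; apply: leq_trans rr' _.
rewrite card_ffun_prod.
under [X in _ <= X]eq_bigr do rewrite card_supported.
rewrite -expn_sum sum_block_msgs; apply: leq_trans.
rewrite -(card_supported F E') -[X in c * X]sum1_card.
rewrite (partition_big T predT) //= big_distrr; apply: leq_sum => w _.
rewrite card_ffun_prod; apply: leq_trans (H w); rewrite leq_mul2l -sum1_card.
by apply/orP; right; rewrite leq_eqVlt; apply/orP; left; apply/eqP/eq_bigl => x; rewrite [RHS]inE.
Qed.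

Lemma block_msgs0 b : b \notin p @: setT -> block_msgs b = set0.
Proof.
move=> bP; apply/setP => e; rewrite !inE; apply/negP => /andP[_ /imsetP[j _ bj]].
by rewrite bj imset_f ?inE in bP.
Qed.

Lemma prod_blocks_le x :
  x \in supported F E' ->
  \prod_(b in p @: setT) #|consistent b (T x)| <= \prod_b #|consistent b (T x)|.
Proof.
move=> xE; rewrite [leqRHS](bigID (mem (p @: setT))) /= leq_pmulr // prodn_cond_gt0 // => b _.
by apply/card_gt0P; exists (restrict b x); exact: restrict_consistent.
Qed.

End Decoupling.

(** * Key generation forces partition connectivity *)

(** Exponents are compared in [decoupling] with [c] equal to [#|F| ^ tau] raised to
    [#|p @: setT| - 1]; the spare factor [#|F| ^ tau] on the right keeps this predecessor out of the
    hypothesis. *)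
Lemma partition_connected_of_fibers (n t : nat) (M : finType) (F : finFieldType)
    (I : 'I_n -> {set M}) (s : 'I_t -> 'I_n) (T : {ffun M -> F} -> {ffun 'I_t -> F})
    (tau : nat) (E' : {set M}) :
  0 < n -> causal I s T ->
  (forall (p : 'I_n -> 'I_n) x, x \in supported F E' ->
     (#|F| ^ tau) ^ #|p @: setT| * #|[set y in supported F E' | T y == T x]| <=
     #|F| ^ tau * \prod_(b in p @: setT) #|consistent I s T E' p b (T x)|) ->
  partition_connected I tau E'.
Proof.
move=> n0 cT H; apply/forallP => p; set m := #|p @: setT|.
have m0 : 0 < m by apply/card_gt0P; exists (p (Ordinal n0)); rewrite imset_f.
have q1 : 1 < #|F| by apply: finNzRing_gt1.
have qt : 0 < #|F| ^ tau by rewrite expn_gt0 (ltnW q1).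
have := @decoupling n t M F I s T E' p cT ((#|F| ^ tau) ^ m.-1).
have hyp w : (#|F| ^ tau) ^ m.-1 * #|[set x in supported F E' | T x == w]| <=
    \prod_b #|consistent I s T E' p b w|.
  have [->|[x]] := set_0Vmem [set x in supported F E' | T x == w].
    by rewrite cards0 muln0.
  rewrite inE => /andP[xE /eqP <-]; apply: leq_trans (prod_blocks_le I s T p xE).
  by rewrite -(leq_pmul2l qt) mulnA -expnS prednK //; exact: H.
move/(_ hyp); rewrite -expnM -expnD leq_exp2l // => le.
rewrite -(prednK m0) mulnS -addnA [leqRHS]addnC leq_add2l.
exact: le.
Qed.

(** Within one transcript the key cuts the data of each block into disjoint parts, one per key
    value; AM-GM over these values yields a factor [#|F| ^ tau] per block. *)
Lemma keys_partition_connected (n t : nat) (M : finType) (F : finFieldType)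
    (I : 'I_n -> {set M}) (s : 'I_t -> 'I_n) (T : {ffun M -> F} -> {ffun 'I_t -> F})
    (tau : nat) :
  0 < n -> \bigcup_j I j = setT -> causal I s T -> generates_keys I tau T ->
  partition_connected I tau setT.
Proof.
move=> n0 cov cT [K [Kj Kunif Kind]].
have q1 : 1 < #|F| by apply: finNzRing_gt1.
apply: (partition_connected_of_fibers n0 cT) => p x0 _.
set P := p @: setT; set w := T x0; set Q := #|F| ^ tau.
have Q0 : 0 < Q by rewrite expn_gt0 (ltnW q1).
have QE : #|{ffun 'I_tau -> F}| = Q by rewrite card_ffun card_ord.
pose N k := #|[set x | (K x == k) && (T x == w)]|.
set Nw := #|[set y in _ | _]|.
have NwE : Nw = #|[set x | T x == w]|.
  by apply: eq_card => x; rewrite [LHS]inE [RHS]inE supportedT.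
(* By uniformity and independence, the inputs with transcript [w] split evenly over the [Q] keys. *)
have NQ k : N k * Q = Nw.
  have Kk0 : 0 < #|[set x | K x == k]|.
    by have := Kunif k; case: #|_| => // /esym/eqP; rewrite mul0n expn_eq0 eqn0Ngt (ltnW q1).
  apply/eqP; rewrite -(eqn_pmul2l Kk0) NwE -Kind -(Kunif k) mulnCA mulnA.
  by rewrite -mulnA mulnC [_ * N k]mulnC mulnA.
have [k0] : exists k : {ffun 'I_tau -> F}, true by exists [ffun=> 0%R].
move=> _; set c := N k0.
have Nc k : N k = c.
  by apply/eqP; rewrite -(eqn_pmul2r Q0) !NQ.
pose A b k := restrict I setT p b @: [set x | (K x == k) && (T x == w)].
have AE b k : A b k \subset consistent I s T setT p b w.
  apply/subsetP => _ /imsetP[x xk ->]; move: xk; rewrite inE => /andP[_ /eqP <-].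
  by apply: restrict_consistent; apply: supportedT.
have E0 e : e \in [set: M] -> clients I e != set0.
  move=> _; have : e \in \bigcup_j I j by rewrite cov inE.
  by case/bigcupP => j _ ej; apply/set0Pn; exists j; rewrite inE.
have prodA k : c <= \prod_(b in P) #|A b k|.
  apply: leq_trans (_ : \prod_b #|A b k| <= _).
    rewrite -(Nc k) -card_ffun_prod /N.
    rewrite -(@card_in_imset _ _ (fun x => [ffun b => restrict I setT p b x])) => [|x y _ _ /ffunP xy].
      apply: subset_leq_card; apply/subsetP => _ /imsetP[x xk ->].
      by rewrite inE; apply/forallP => b; rewrite ffunE imset_f.
    apply: (restrict_inj (p := p) E0 (supportedT x) (supportedT y)) => b.
    by have := xy b; rewrite !ffunE.
  rewrite (bigID (mem P)) /= -[leqRHS]muln1 leq_mul2l; apply/orP; right.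
  apply: leq_trans (_ : _ <= \prod_(b | b \notin P) 1) _; last by rewrite big1_eq.
  apply: leq_prod => b bP.
  apply: leq_trans (subset_leq_card (AE b k)) _.
  apply: leq_trans (_ : #|supported F (block_msgs I setT p b)| <= _).
    by apply: subset_leq_card; apply/subsetP => z; rewrite inE => /andP[].
  by rewrite card_supported block_msgs0 // cards0.
(* A client of block [b] computes the key from [z] and [w], so [z] occurs for one key only. *)
have sumA b : b \in P -> \sum_k #|A b k| <= #|consistent I s T setT p b w|.
  case/imsetP => j _ bj; apply: sum_card_disjoint => // k k'.
  rewrite -setI_eq0; apply: contraNT => /set0Pn[z /setIP[]].
  case/imsetP => x + zx /imsetP[y + zy]; rewrite !inE.
  move=> /andP[/eqP <- /eqP xw] /andP[/eqP <- /eqP yw]; apply/eqP.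
  apply: (Kj j); last by rewrite xw yw.
  by apply: (@restrict_agree n M F I setT p); rewrite ?supportedT // -bj -zx.
have AGM b : b \in P -> Q ^ Q * \prod_k #|A b k| <= #|consistent I s T setT p b w| ^ Q.
  move=> bP; rewrite -QE; apply: leq_trans (nat_AGM _) _.
  by rewrite leq_exp2r ?QE ?sumA.
(* The AM-GM bounds are multiplied over the blocks, the products over [b] and [k] exchanged, and
   [prodA] applied for each key; the exponent [Q] is then cancelled. *)
have : (Q ^ #|P| * c) ^ Q <= (\prod_(b in P) #|consistent I s T setT p b w|) ^ Q.
  rewrite [leqRHS](big_morph (fun m => m ^ Q) (fun a b => expnMn a b Q) (exp1n Q)).
  apply: leq_trans (leq_prod AGM).
  rewrite big_split /= prod_nat_const expnMn -!expnM [#|P| * Q]mulnC leq_mul2l.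
  apply/orP; right; rewrite exchange_big /= -[X in c ^ X]QE -prod_nat_const.
  by apply: leq_prod => k _; exact: prodA.
rewrite leq_exp2r // => le; rewrite -(NQ k0) -/c mulnA [_ * Q]mulnC leq_mul2l.
by rewrite le orbT.
Qed.

(** * Linear protocols *)

Lemma intermediate_vspace (F : fieldType) (vT : vectType F) (U W : {vspace vT}) k :
  (U <= W)%VS -> \dim U + k <= \dim W ->
  exists N, [/\ (U <= N)%VS, (N <= W)%VS & \dim N + k = \dim W].
Proof.
move=> UW dUW; have [m] := ubnP (\dim W - (\dim U + k)).
elim: m U UW dUW => // m IH U UW dUW lt.
have [dE|dN] := eqVneq (\dim U + k) (\dim W); first by exists U.
have : ~~ (W <= U)%VS.
  by apply: contraNN dN => /dimvS; rewrite eqn_leq dUW /= => le; rewrite (leq_trans le) ?leq_addr.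
case/subvPn => x xW xU; have dx := dim_addv_line U x; rewrite xU addn1 in dx.
have ltk : \dim U + k < \dim W by rewrite ltn_neqAle dN.
have [||//|N [UN NW dN']] := IH (U + <[x]>)%VS.
- by rewrite subv_add UW -memvE.
- by rewrite dx addSn.
- by rewrite dx addSn subnS -ltnS prednK // subn_gt0.
by exists N; split=> //; apply: subv_trans UN; apply: addvSl.
Qed.

(** Steinitz: a largest set of coordinates independent of [N] spans a complement. *)
Lemma coordsp_complement (F : fieldType) (M : finType) (N : {vspace {ffun M -> F^o}}) :
  exists E' : {set M}, (coordsp F E' :&: N = 0)%VS /\ (coordsp F E' + N = fullv)%VS.
Proof.
pose P (A : {set M}) := \dim (coordsp F A + N) == #|A| + \dim N.
have P0 : P set0 by rewrite /P /coordsp fspan0 add0v cards0.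
case: (@arg_maxnP _ set0 P (fun A => #|A|) P0) => A /eqP PA Amax; exists A; split.
  apply/eqP; rewrite -dimv_eq0 -(eqn_add2l (\dim (coordsp F A + N))).
  by rewrite dimv_sum_cap dim_coordsp PA addn0.
apply/eqP; rewrite eqEsubv subvf -coordspT; apply/fspan_subP => i _.
apply: contraT => iA; have iA' : i \notin A.
  by apply: contra iA => iA; apply: subvP (addvSl _ _) _ _; apply: mem_fspan.
have : P (i |: A).
  rewrite /P /coordsp setUC fspanU fspan1 -addvA [(_ + N)%VS]addvC addvA dim_addv_line.
  by rewrite -/(coordsp F A) iA PA setUC cardsU1 iA' addn1.
by move/Amax; rewrite /= cardsU1 iA' ltnn.
Qed.

Lemma card_vspace_ffun (F : finFieldType) (M : finType) (U : {vspace {ffun M -> F^o}}) :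
  #|[set x : {ffun M -> F} | (x : {ffun M -> F^o}) \in U]| = #|F| ^ \dim U.
Proof.
rewrite -[RHS](@card_vspace F {ffun M -> F} (Vector.class {ffun M -> F^o})).
by apply: eq_card => x; rewrite inE.
Qed.

(** [W] is the kernel of the transcript, and [U] is spanned by the vectors of [W] invisible to some
    client. On [W] the key is constant along [U], so [U] has codimension at least [tau] in [W]; [E']
    is a coordinate complement of a space [N] between them, of codimension [tau] in [W]. *)
Lemma linear_lower_bound (n t : nat) (M : finType) (F : finFieldType)
    (I : 'I_n -> {set M}) (tau : nat) :
  0 < n -> linear_generates F I tau t ->
  exists E', partition_connected I tau E' /\ #|E'| <= t + tau.
Proof.
move=> n0 [s [c [cI [K [Kj Kunif Kind]]]]]; set T := linear_transcript c in Kj Kunif Kind.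
pose V := {ffun M -> F^o}.
have q1 : 1 < #|F| by apply: finNzRing_gt1.
have Tlin : linear (T : V -> {ffun 'I_t -> F^o}).
  move=> k x y; apply/ffunP => r; rewrite !ffunE scaler_sumr -big_split.
  apply: eq_bigr => i _; rewrite !ffunE mulrDr; congr (_ + _)%R.
  by rewrite /GRing.scale /= mulrCA.
pose Tl : {linear V -> {ffun 'I_t -> F^o}} :=
  HB.pack (T : V -> {ffun 'I_t -> F^o}) (GRing.isLinear.Build F V {ffun 'I_t -> F^o} *:%R T Tlin).
pose W := lker (linfun Tl).
have memW x : (x \in W) = (T x == 0%R) by rewrite memv_ker lfunE.
have TB (x y : V) : T (x - y)%R = (T x - T y :> {ffun 'I_t -> F^o})%R := raddfB Tl x y.
have dimW : #|M| <= \dim W + t.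
  rewrite -(dim_ffunv F M) -(limg_ker_dim (linfun Tl) fullv) capfv leq_add2l.
  by rewrite (leq_trans (dimvS (subvf _))) // dim_ffunv card_ord.
have causalT : causal I s T.
  move=> r x y xy _; rewrite !ffunE; apply: eq_bigr => i _.
  by have [->|/cI/xy->//] := eqVneq (c r i) 0%R; rewrite !mul0r.
pose Z j := coordsp F (~: I j).
pose U := (\sum_j (W :&: Z j))%VS.
have UW : (U <= W)%VS by apply/subv_sumP => j _; apply: capvSl.
have KU u : u \in U -> forall x, x \in W -> K (x + u)%R = K x.
  suff : forall u, u \in U -> u \in W /\ forall x, x \in W -> K (x + u)%R = K x.
    by move=> H /H[].
  move=> u' /memv_sumP[v vU ->]; apply:
    (big_ind (fun u => u \in W /\ forall x, x \in W -> K (x + u)%R = K x)).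
  - by split=> [|x xW]; rewrite ?mem0v ?addr0.
  - move=> a b [aW Ka] [bW Kb]; split=> [|x xW]; first exact: rpredD.
    by rewrite addrA Kb ?rpredD // Ka.
  - move=> j _; have /(_ isT) := vU j; rewrite memv_cap => /andP[vW /coordspP vZ].
    split=> // x xW; apply: (Kj j) => [i ij|].
      by rewrite ffunE (vZ i) ?addr0 // inE ij.
    by move: (rpredD xW vW) (xW); rewrite !memW => /eqP -> /eqP ->.
(* Every key occurs with the zero transcript, and on [W] the key depends only on the component in
   [W :\: U]. *)
have dimWU : \dim U + tau <= \dim W.
  rewrite -(dimv_cap_compl W U) (capv_idPr UW) leq_add2l -(leq_exp2l _ _ q1).
  rewrite -card_vspace_ffun -[tau in leqLHS]card_ord -card_ffun -cardsT.
  rewrite (leq_trans _ (leq_imset_card K _)) // subset_leq_card //; apply/subsetP => k _.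
  have : 0 < #|[set x | K x == k & T x == [ffun=> 0%R]]|.
    rewrite -(ltn_pmul2r (_ : 0 < #|F| ^ #|M|)) ?expn_gt0 ?(ltnW q1) // Kind muln_gt0.
    apply/andP; split.
      have := Kunif k; case: #|_| => // /esym/eqP.
      by rewrite mul0n expn_eq0 eqn0Ngt (ltnW q1).
    apply/card_gt0P; exists (0%R : V); rewrite inE; apply/eqP.
    exact: (raddf0 Tl).
  case/card_gt0P => x; rewrite inE => /andP[/eqP <- T0].
  have xW : x \in W by rewrite memW.
  have : x \in (W :\: U + U)%VS by rewrite addv_diff (addv_idPl UW).
  case/memv_addP => v vD [u uU xE]; apply/imsetP; exists v; first by rewrite inE.
  by rewrite xE KU // (subvP (diffvSl _ _) _ vD).
have [N [UN NW dimN]] := intermediate_vspace UW dimWU.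
have [E' [EN0 ENf]] := coordsp_complement N; exists E'.
have dimEN : #|E'| + \dim N = #|M|.
  by rewrite -(dim_ffunv F M) -ENf -(dim_coordsp F) -dimv_sum_cap EN0 dimv0 addn0.
split; last first.
  by rewrite -(leq_add2r (\dim N)) dimEN (leq_trans dimW) // -dimN addnC [\dim N + _]addnC addnA.
have dimEW : \dim (coordsp F E' :&: W) = tau.
  have EWf : (coordsp F E' + W = fullv)%VS.
    by apply/eqP; rewrite eqEsubv subvf -ENf addvS.
  apply/eqP; rewrite -(eqn_add2l (\dim (coordsp F E' + W))) dimv_sum_cap EWf dim_ffunv.
  by rewrite dim_coordsp -dimN -dimEN addnA.
apply: (partition_connected_of_fibers n0 causalT) => p x xE.
set fib := [set y in _ | _].
have fibP y : reflect (y \in supported F E' /\ T y = T x) (y \in fib).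
  by rewrite [y \in fib]inE; apply: (iffP andP) => -[yE /eqP].
(* The fibre is a translate of [coordsp F E' :&: W]. *)
have card_fib : #|fib| = #|F| ^ tau.
  rewrite -dimEW -card_vspace_ffun.
  rewrite -[RHS](card_imset _ (addrI (x : V))); apply: eq_card => y; apply/fibP/imsetP.
    case=> /supportedP yE Ty; exists (y - x : V)%R; last by rewrite addrC subrK.
    rewrite inE memv_cap memW TB Ty subrr eqxx andbT; apply/coordspP => i iE.
    by rewrite !ffunE yE // (supportedP _ _ xE) // subrr.
  case=> z; rewrite inE memv_cap memW => /andP[/coordspP zE /eqP Tz] ->; split.
    by apply/supportedP => i iE; rewrite ffunE zE // (supportedP _ _ xE) // addr0.
  by rewrite (raddfD Tl (x : V) z : T _ = _) /= -/(T z) Tz addr0.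
(* Two inputs of the fibre that look alike to client [j] differ by a vector of [coordsp F E' :&: U],
   which is zero since [U] lies in [N]. *)
have consist b : b \in p @: setT -> #|F| ^ tau <= #|consistent I s T E' p b (T x)|.
  case/imsetP => j _ ->; rewrite -card_fib -(@card_in_imset _ _ (restrict I E' p (p j))).
    apply: subset_leq_card; apply/subsetP => _ /imsetP[y /fibP[yE <-] ->].
    exact: restrict_consistent.
  move=> y y' /fibP[yE Ty] /fibP[yE' Ty'] /(restrict_agree yE yE') agr.
  have : (y - y' : V)%R \in (coordsp F E' :&: N)%VS.
    rewrite memv_cap; apply/andP; split.
      apply/coordspP => i iE.
      by rewrite !ffunE (supportedP _ _ yE) // (supportedP _ _ yE') // subrr.
    apply: subvP UN _ _; apply: subvP (_ : W :&: Z j <= U)%VS _ _.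
      exact: (sumv_sup j).
    rewrite memv_cap memW TB Ty Ty' subrr eqxx /=; apply/coordspP => i.
    by rewrite inE negbK => /agr; rewrite !ffunE => ->; rewrite subrr.
  by rewrite EN0 memv0 subr_eq0 => /eqP.
rewrite card_fib mulnC leq_mul2l -prod_nat_const; apply/orP; right.
exact: leq_prod.
Qed.

(** * Generic vectors and submodular functions *)

(** If the vector [v] found for [s] lies in [U], take [w] in [A] outside [U]: all [k *: v + w] avoid
    [U], and each space of [s] excludes at most one [k]. *)
Lemma vspace_avoid (F : finFieldType) (vT : vectType F) (A : {vspace vT})
    (s : seq {vspace vT}) :
  size s <= #|F| -> (forall U, U \in s -> ~~ (A <= U)%VS) ->
  exists2 v, v \in A & (forall U, U \in s -> v \notin U).
Proof.
elim: s => [_ _|U s IH ltF AN]; first by exists 0%R; rewrite ?mem0v.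
have [W Ws|v vA vs] := IH (ltnW ltF); first by apply: AN; rewrite inE Ws orbT.
have [vU|vU] := boolP (v \in U); last first.
  by exists v => // W; rewrite inE => /orP[/eqP->//|]; apply: vs.
have [w wA wU] := subvPn (AN U (mem_head _ _)).
pose bad k := has (fun W : {vspace vT} => k *: v + w \in W)%R s.
have /existsP[k kgood] : [exists k, ~~ bad k].
  apply: contraT; rewrite negb_exists => /forallP allbad.
  have badk k : bad k by have := allbad k; rewrite negbK.
  have lt_find k : find (fun W : {vspace vT} => k *: v + w \in W)%R s < size s.
    by rewrite -has_find; exact: badk.
  pose g k := Ordinal (lt_find k).
  suff /leq_card : injective g by rewrite card_ord leqNgt ltF.
  move=> k k' /(congr1 val) /= gk; apply/eqP.
  have := nth_find 0%VS (badk k); have := nth_find 0%VS (badk k').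
  rewrite -gk; set W := nth _ _ _ => k'W kW.
  have vW : v \notin W by apply: vs; apply: mem_nth.
  have : ((k - k') *: v)%R \in W.
    have -> : ((k - k') *: v = (k *: v + w) - (k' *: v + w))%R.
      by rewrite opprD addrACA subrr addr0 scalerBl.
    exact: rpredB.
  by rewrite rpredZeq (negbTE vW) orbF subr_eq0.
exists (k *: v + w)%R; first by rewrite rpredD ?rpredZ.
move=> W; rewrite inE => /orP[/eqP->|Ws]; first by rewrite rpredDl ?rpredZ.
by apply: contra kgood => kW; apply/hasP; exists W.
Qed.

Lemma bigcup_closed (T : finType) (Q : pred {set T}) :
  (forall A B, Q A -> Q B -> Q (A :|: B)) -> (exists S, Q S) ->
  Q (\bigcup_(S | Q S) S).
Proof.
move=> QU [S QS].
have [/eqP|//] : (\bigcup_(S | Q S) S == set0) \/ Q (\bigcup_(S | Q S) S).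
  apply: (big_ind (fun X => X == set0 \/ Q X)) => [|A B|A QA]; [by left| |by right].
  move=> [/eqP->|QA] [/eqP->|QB]; rewrite ?setU0 ?set0U; by [left|right|right; apply: QU].
move=> U0; have : S \subset set0 by rewrite -U0 bigcup_sup.
by rewrite U0 subset0 => /eqP <-.
Qed.

Section Submodular.
Variables (J : finType) (h : {set J} -> nat) (c : nat).
Implicit Types (S A B : {set J}) (d : J -> nat).
Hypothesis submod : forall A B, h (A :|: B) + h (A :&: B) <= h A + h B.

(** The shift [c] is charged to nonempty sets only, so uncrossing two sets requires that they
    intersect. *)
Definition feasible d := forall S, S != set0 -> \sum_(j in S) d j + c <= h S.

Definition tight d S := (S != set0) && (\sum_(j in S) d j + c == h S).

(** Feasibility of union and intersection, added up, leaves no slack in the submodular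
    inequality. *)
Lemma tightU d A B : feasible d -> A :&: B != set0 ->
  tight d A -> tight d B -> tight d (A :|: B).
Proof.
move=> fd AB /andP[A0 /eqP tA] /andP[B0 /eqP tB].
have U0 : A :|: B != set0.
  by apply: contraNN A0; rewrite setU_eq0 => /andP[].
rewrite /tight U0 eqn_leq fd //= -(leq_add2r (h (A :&: B))).
apply: leq_trans (submod A B) _; rewrite -tA -tB.
apply: leq_trans (_ : \sum_(j in A :|: B) d j + c + (\sum_(j in A :&: B) d j + c) <= _); last first.
  by rewrite leq_add2l fd.
rewrite !addnA leq_add2r addnAC [leqRHS]addnAC leq_add2r.
have -> : \sum_(j in A :|: B) d j = \sum_(j in A) d j + \sum_(j in B :\: A) d j.
  by rewrite (big_setID A) /= setUK setDUl setDv set0U.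
rewrite [\sum_(j in B) _](big_setID A) /= -addnA leq_add2l addnC.
by rewrite setIC.
Qed.

(** For feasible [d] and union-closed [Q], this is the largest tight set through [u] satisfying [Q],
    if there is one. [Q] is trivial for the partition certificate and excludes the transmitter when
    a transmission is chosen. *)
Definition tight_hull d (Q : pred {set J}) u :=
  \bigcup_(S | [&& tight d S, Q S & u \in S]) S.

Lemma tight_hullP d (Q : pred {set J}) u S : feasible d ->
  (forall A B, Q A -> Q B -> Q (A :|: B)) -> tight d S -> Q S -> u \in S ->
  [/\ tight d (tight_hull d Q u), Q (tight_hull d Q u) & S \subset tight_hull d Q u].
Proof.
move=> fd QU tS QS uS.
have hS : [&& tight d S, Q S & u \in S] by rewrite tS QS.
have [||tH QH _] := and3P (bigcup_closed (Q := fun S => [&& tight d S, Q S & u \in S]) _ _).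
- move=> A B /and3P[tA QA uA] /and3P[tB QB uB].
  by rewrite tightU ?QU ?inE ?uA //; apply/set0Pn; exists u; rewrite inE uA.
- by exists S.
- by split=> //; apply: bigcup_sup.
Qed.

(* Edmonds: the largest total of a feasible vector is the least value of
   [\sum_b (h b - c)] over partitions; a vector that cannot be increased has
   a partition into maximal tight sets as certificate. *)
Lemma feasible_total N :
  (forall S, S != set0 -> c <= h S) ->
  (forall p : J -> J, N + c * #|p @: setT| <=
     \sum_(b in p @: setT) h [set j | p j == b]) ->
  exists2 d, feasible d & \sum_j d j = N.
Proof.
move=> h0 hp; suff H m : m <= N -> exists2 d, feasible d & \sum_j d j = m by exact: H.
elim: m => [_|m IH mN].
  by exists (fun=> 0) => [S S0|]; rewrite big1 ?add0n ?h0.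
have [d fd dm] := IH (ltnW mN).
pose inc j k := d k + (k == j).
have sum_inc j S : \sum_(k in S) inc j k = \sum_(k in S) d k + (j \in S).
  rewrite big_split /=; congr (_ + _); have [jS|jS] := boolP (j \in S).
    by rewrite (bigD1 j) //= eqxx big1 // => k /andP[_ /negbTE->].
  by rewrite big1 // => k kS; case: eqP => // kj; rewrite -kj kS in jS.
pose feasb d := [forall S, (S != set0) ==> (\sum_(j in S) d j + c <= h S)].
have feasP d' : reflect (feasible d') (feasb d').
  by apply: (iffP forallP) => H S; apply/implyP; apply: H.
have [j /feasP fj|noinc] := pickP (fun j => feasb (inc j)).
  exists (inc j) => //; have := sum_inc j setT; rewrite inE addn1 -dm => sE.
  rewrite -[in RHS](eq_bigl _ _ (in_setT (T := J))) -sE.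
  by apply: eq_bigl => k; rewrite inE.
(* Raising [d j] violates the bound of some set, which must contain [j] and be tight for [d]. *)
have ext j : exists2 S, tight d S & j \in S.
  have /negbT := noinc j; rewrite negb_forall => /existsP[S].
  rewrite negb_imply -ltnNge sum_inc => /andP[S0 lt].
  have [jS|jS] := boolP (j \in S); last first.
    by move: lt; rewrite (negbTE jS) addn0 ltnNge fd.
  exists S => //; rewrite /tight S0 eqn_leq fd //=.
  by move: lt; rewrite jS addn1 addSn ltnS.
pose H := tight_hull d predT.
have HP j : tight d (H j) /\ j \in H j.
  have [S tS jS] := ext j.
  have [//|tH _ SH] := tight_hullP (Q := predT) fd _ tS isT jS.
  by split=> //; exact: (subsetP SH).
have Hmax j S : tight d S -> j \in S -> S \subset H j.
  by move=> tS jS; have [] := tight_hullP (Q := predT) fd (fun _ _ _ _ => isT) tS isT jS.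
have Heq j k : k \in H j -> H k = H j.
  move=> kj; have [tj jj] := HP j; have [tk kk] := HP k.
  have jk := Hmax _ _ tj kj.
  by apply/eqP; rewrite eqEsubset jk Hmax // (subsetP jk).
(* The pick depends only on the set [H j], so the fibres of [p] are the hulls; the default is never
   reached because [j] is in [H j]. *)
pose p j := odflt j [pick u in H j].
have pH j : p j \in H j.
  by rewrite /p; case: pickP => //= /(_ j); have [_ ->] := HP j.
have pE j k : (p j == p k) = (k \in H j).
  apply/eqP/idP => [pjk|/Heq Hk].
    have := pH j; rewrite pjk => /Heq <-; rewrite (Heq _ _ (pH k)).
    by have [] := HP k.
  by rewrite /p Hk; case: pickP => //= /(_ j); have [_ ->] := HP j.
have : \sum_j d j + c * #|p @: setT| = \sum_(b in p @: setT) h [set j | p j == b].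
  rewrite mulnC -sum_nat_const (partition_big p (mem (p @: setT))) /=; last first.
    by move=> j _; apply: imset_f.
  rewrite -big_split /=; apply: eq_bigr => _ /imsetP[j _ ->].
  have -> : [set k | p k == p j] = H j by apply/setP => k; rewrite inE eq_sym pE.
  have [/andP[_ /eqP <-] _] := HP j; congr (_ + _); apply: eq_bigl => k.
  by rewrite eq_sym pE.
move=> E; have := hp p; rewrite -E leq_add2r dm leqNgt.
by rewrite mN.
Qed.

End Submodular.

(** * Constructing a linear protocol *)

Section DotProduct.
Variables (F : finFieldType) (M : finType).
Local Notation V := {ffun M -> F^o}.
Local Open Scope ring_scope.

Definition dot (a : V) (x : {ffun M -> F}) : F := \sum_i a i * x i.

Lemma dotDl a b x : dot (a + b) x = dot a x + dot b x.
Proof. by rewrite /dot -big_split; apply: eq_bigr => i _; rewrite ffunE mulrDl. Qed.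

Lemma dotZl k a x : dot (k *: a) x = k * dot a x.
Proof. by rewrite /dot mulr_sumr; apply: eq_bigr => i _; rewrite ffunE -mulrA. Qed.

Lemma dot0l x : dot 0 x = 0.
Proof. by rewrite /dot big1 // => i _; rewrite ffunE mul0r. Qed.

Lemma dotDr a (x y : {ffun M -> F}) : dot a [ffun i => x i + y i] = dot a x + dot a y.
Proof. by rewrite /dot -big_split; apply: eq_bigr => i _; rewrite ffunE mulrDr. Qed.

Lemma dotBr a (x y : {ffun M -> F}) : dot a [ffun i => x i - y i] = dot a x - dot a y.
Proof. by rewrite /dot -sumrB; apply: eq_bigr => i _; rewrite ffunE mulrBr. Qed.

Lemma dot_span (X : seq V) a x :
  (forall b, b \in X -> dot b x = 0) -> a \in <<X>>%VS -> dot a x = 0.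
Proof.
move=> X0 /(coord_span (X := in_tuple X)) ->.
elim/big_ind: _ => [|b c b0 c0|i _]; first exact: dot0l.
  by rewrite dotDl b0 c0 addr0.
by rewrite dotZl X0 ?mulr0 // mem_nth.
Qed.

(** Coordinates in the free family give a functional with the prescribed values; its values on the
    [delta j] form [x]. *)
Lemma dot_surj m (X : m.-tuple V) (w : 'I_m -> F) : free X ->
  exists x : {ffun M -> F}, forall i, dot (tnth X i) x = w i.
Proof.
move=> fX; pose f (v : V) := \sum_k coord X k v * w k.
exists [ffun j => f (delta j)] => i; transitivity (f (tnth X i)).
  rewrite {2}[tnth X i]ffun_sum_delta /f /dot.
  under [RHS]eq_bigr do rewrite linear_sum /= mulr_suml.
  rewrite exchange_big; apply: eq_bigr => j _; rewrite ffunE mulr_sumr.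
  by apply: eq_bigr => k _; rewrite linearZ /= mulrA.
rewrite /f (bigD1 i) //= (tnth_nth 0) coord_free // eqxx mul1r big1 ?addr0 // => k ki.
by rewrite coord_free // eq_sym (negbTE ki) mul0r.
Qed.

(** The fibres of [G] are translates of each other, hence equal in size, and there are [#|F| ^ m] of
    them. *)
Lemma card_solutions m (X : m.-tuple V) (w : 'I_m -> F) : free X ->
  (#|[set x | [forall i, dot (tnth X i) x == w i]]| * #|F| ^ m = #|F| ^ #|M|)%N.
Proof.
move=> fX; pose G (x : {ffun M -> F}) := [ffun i => dot (tnth X i) x].
have fibE (u : {ffun 'I_m -> F}) :
    #|[set x | G x == u]| = #|[set x | [forall i, dot (tnth X i) x == w i]]|.
  have [x0 x0E] := dot_surj (fun i => w i - u i) fX.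
  have inj : injective (fun x : {ffun M -> F} => [ffun i => x i + x0 i]).
    move=> x y /ffunP xy; apply/ffunP => i; have := xy i; rewrite !ffunE; exact: addIr.
  rewrite -(card_imset _ inj); apply: eq_card => y; rewrite [RHS]inE.
  apply/imsetP/forallP => [[x]|yw].
    rewrite inE => /eqP Gx -> i.
    by rewrite dotDr x0E -Gx ffunE addrC subrK.
  exists [ffun i => y i - x0 i]; last by apply/ffunP => i; rewrite !ffunE subrK.
  rewrite inE; apply/eqP/ffunP => i; rewrite ffunE dotBr x0E (eqP (yw i)).
  by rewrite opprB addrC subrK.
rewrite -[in RHS]card_ffun -[RHS]sum1_card (partition_big G predT) //=.
rewrite (eq_bigr (fun=> #|[set x | [forall i, dot (tnth X i) x == w i]]|)) => [|u _].
  by rewrite sum_nat_const card_ffun card_ord mulnC.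
by rewrite sum1_card -(fibE u); apply: eq_card => x; rewrite [RHS]inE.
Qed.

End DotProduct.

Section Achievability.
Variables (n : nat) (M : finType) (F : finFieldType) (I : 'I_n -> {set M}).
Variables (tau : nat) (E' : {set M}).
Hypotheses (n1 : 1 < n) (nF : n < #|F|) (cover : \bigcup_j I j = setT).
Hypothesis pcE : partition_connected I tau E'.
Local Notation V := {ffun M -> F^o}.

Definition known (S : {set 'I_n}) : {set M} := [set e in E' | ~~ [disjoint clients I e & S]].

Lemma knownP (S : {set 'I_n}) e :
  reflect (e \in E' /\ exists2 j, j \in S & e \in I j) (e \in known S).
Proof.
rewrite inE -setI_eq0; apply: (iffP andP) => -[eE].
  by case/set0Pn => j; rewrite !inE => /andP[ej jS]; split=> //; exists j.
by case=> j jS ej; split=> //; apply/set0Pn; exists j; rewrite !inE ej.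
Qed.

Lemma knownS (A B : {set 'I_n}) : A \subset B -> known A \subset known B.
Proof.
move=> /subsetP AB; apply/subsetP => e /knownP[eE [j /AB jB ej]].
by apply/knownP; split=> //; exists j.
Qed.

Lemma knownU (A B : {set 'I_n}) : known (A :|: B) = known A :|: known B.
Proof.
apply/setP => e; apply/knownP/setUP => [[eE [j]]|[]/knownP[eE [j jS ej]]].
- by rewrite inE => /orP[jA|jB] ej; [left|right]; apply/knownP; split=> //; exists j.
- by split=> //; exists j; rewrite // inE jS.
- by split=> //; exists j; rewrite // inE jS orbT.
Qed.

Lemma knownT : known setT = E'.
Proof.
apply/setP => e; apply/knownP/idP => [[]//|eE]; split=> //.
have : e \in \bigcup_j I j by rewrite cover inE.
by case/bigcupP => j _ ej; exists j; rewrite // inE.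
Qed.

Lemma known_sub S : known S \subset E'.
Proof. by apply/subsetP => e /knownP[]. Qed.

(** For a partition into two blocks, the inequality gives [tau] hyperedges meeting both, all known
    in either block. The set of all clients is handled through a singleton, proper as [1 < n]. *)
Lemma tau_le_known S : S != set0 -> tau <= #|known S|.
Proof.
have proper_case (A : {set 'I_n}) a b : a \in A -> b \notin A -> tau <= #|known A|.
  move=> aA bA; pose p j := if j \in A then a else b.
  have ab : a != b by apply: contraNneq bA => <-.
  have c2 : #|[set a; b]| = 2 by rewrite cards2 ab.
  have p2 : 2 <= #|p @: setT|.
    rewrite -c2 subset_leq_card //.
    rewrite subUset !sub1set; apply/andP; split; apply/imsetP.
      by exists a; rewrite // /p aA.
    by exists b; rewrite // /p (negbTE bA).
  have pe e : e \in E' -> #|p @: clients I e| <= (e \in known A) + 1.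
    move=> eE; have [ek|ek] := boolP (e \in known A).
      apply: leq_trans (_ : #|[set a; b]| <= _); last by rewrite c2.
      rewrite subset_leq_card //.
      by apply/subsetP => _ /imsetP[j _ ->]; rewrite !inE /p; case: ifP; rewrite eqxx ?orbT.
    rewrite -(cards1 b) subset_leq_card //; apply/subsetP => x /imsetP[j]; rewrite inE => ej ->.
    have jA : j \notin A.
      apply: contra ek => jA; apply/knownP; split=> //.
      by exists j; move: ej; rewrite ?inE.
    by rewrite /p (negbTE jA).
  have := partition_connectedP p pcE.
  have : \sum_(e in E') #|p @: clients I e| <= #|known A| + #|E'|.
    apply: (@leq_trans (\sum_(e in E') ((e \in known A) + 1))); first exact: leq_sum.
    rewrite big_split /= sum1_card leq_add2r.
    rewrite -sum1_card [leqRHS]big_mkcond [leqLHS]big_mkcond leq_sum // => e _.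
    by case: (e \in E'); case: (e \in known A).
  move=> h1 h2; rewrite -(leq_add2r (#|E'| + tau)) addnA.
  apply: leq_trans (_ : tau * #|p @: setT| + #|E'| <= _).
    by rewrite addnAC leq_add2r addnn -muln2 leq_mul2l p2 orbT.
  by apply: leq_trans h2 _; rewrite addnA leq_add2r.
case/set0Pn => a aS; have [b bS|ST] := pickP (fun b => b \notin S).
  exact: proper_case aS bS.
have [b ba] : exists b, b != a.
  have : 0 < #|[set~ a]| by rewrite cardsC1 card_ord -subn1 subn_gt0.
  by case/card_gt0P => b; rewrite !inE; exists b.
apply: leq_trans (_ : #|known [set a]| <= _).
  by apply: (proper_case _ a b); rewrite ?inE.
by rewrite subset_leq_card // knownS // sub1set.
Qed.

Lemma block_msgs_known p b : block_msgs I E' p b = known [set j | p j == b].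
Proof.
apply/setP => e; rewrite inE; apply/andP/knownP => [[eE /imsetP[j]]|[eE [j]]].
  by rewrite inE => ej bj; split=> //; exists j; rewrite // inE bj.
by rewrite inE => /eqP <- ej; rewrite eE imset_f ?inE.
Qed.

Lemma card_known_submodular A B :
  #|known (A :|: B)| + #|known (A :&: B)| <= #|known A| + #|known B|.
Proof.
rewrite knownU -[leqRHS]cardsUI leq_add2l subset_leq_card //.
by rewrite subsetI !knownS ?subsetIl ?subsetIr.
Qed.

Lemma tau_le_card : tau <= #|E'|.
Proof.
rewrite -[E']knownT tau_le_known //; apply/set0Pn.
by exists (Ordinal (ltnW n1)); rewrite inE.
Qed.

(** Summed over blocks, [#|known S|] counts each [e] once per block it meets, so partition
    connectivity supplies the hypothesis of [feasible_total]. *)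
Lemma transmission_counts : exists2 d : 'I_n -> nat,
  feasible (fun S => #|known S|) tau d & \sum_j d j = #|E'| - tau.
Proof.
apply: feasible_total; [exact: card_known_submodular|exact: tau_le_known|].
move=> p; rewrite -(leq_add2r tau) addnAC subnK ?tau_le_card // addnC.
apply: leq_trans (partition_connectedP p pcE) _; rewrite leq_add2r -sum_block_msgs.
rewrite (bigID (mem (p @: setT))) /= [X in _ + X]big1 ?addn0 => [|b /block_msgs0->]; last first.
  by rewrite cards0.
by apply: leq_sum => b _; rewrite block_msgs_known.
Qed.

Definition ksp S : {vspace V} := coordsp F (known S).

Lemma kspU A B : ksp (A :|: B) = (ksp A + ksp B)%VS.
Proof. by rewrite /ksp knownU /coordsp fspanU. Qed.

Lemma kspS (A B : {set 'I_n}) : A \subset B -> (ksp A <= ksp B)%VS.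
Proof. by move=> AB; apply: fspanS; apply: knownS. Qed.

Lemma ksp_submodular (R : {vspace V}) A B :
  \dim (R + ksp (A :|: B)) + \dim (R + ksp (A :&: B)) <=
  \dim (R + ksp A) + \dim (R + ksp B).
Proof.
rewrite -[leqRHS]dimv_sum_cap kspU leq_add // dimvS //.
  rewrite subv_add (subv_trans (addvSl R (ksp A)) (addvSl _ _)) /=.
  by rewrite addvS ?addvSr.
by rewrite subv_cap !addvS ?kspS ?subsetIl ?subsetIr.
Qed.

(* Each step picks a vector known to the transmitter [i] that is unknown, given
   the previous transmissions, to every tight set of clients avoiding [i].  The
   union of those containing a given client is tight again, so it suffices to
   avoid [n < #|F|] subspaces. *)
Lemma transmissions m (d : 'I_n -> nat) (R : {vspace V}) :
  \sum_j d j = m ->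
  feasible (fun S => \dim (R + ksp S)) (\dim R + tau) d ->
  (R <= coordsp F E')%VS -> \dim R + tau + m = #|E'| ->
  exists L : seq ('I_n * V),
    [/\ size L = m, forall x, x \in L -> x.2 \in coordsp F (I x.1),
        \dim (R + <<map snd L>>) = \dim R + m,
        (R + <<map snd L>> <= coordsp F E')%VS &
        forall j, (coordsp F E' <= R + <<map snd L>> + ksp [set j])%VS].
Proof.
elim: m d R => [|m IH] d R dm fd RE dimR.
  (* With no transmission left, feasibility at the singleton of [j] already forces dimension
     [#|E'|]. *)
  exists [::]; rewrite span_nil addv0 addn0; split=> // j.
  have RkE : (R + ksp [set j] <= coordsp F E')%VS.
    by rewrite subv_add RE fspanS // known_sub.
  rewrite -(geq_leqif (dimv_leqif_sup RkE)) dim_coordsp -dimR addn0.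
  apply: leq_trans (fd [set j] _); last by apply/set0Pn; exists j; rewrite inE.
  by rewrite leq_addl.
have [i di] : exists i, 0 < d i.
  apply/existsP; apply: contraT; rewrite negb_exists => /forallP d0.
  by move: dm; rewrite big1 // => j _; have := d0 j; rewrite -eqn0Ngt => /eqP.
set c := \dim R + tau in fd dimR.
set h := fun S => \dim (R + ksp S) in fd.
have i0 : [set i] != set0 by apply/set0Pn; exists i; rewrite inE.
pose H := tight_hull h c d (fun S => i \notin S).
(* One space per client [u]; if no tight set avoiding [i] contains [u], the default is [R], so every
   member of [Us] contains [R]. *)
pose Us := [seq if tight h c d (H u) && (i \notin H u)
  then (R + ksp (H u))%VS else R | u <- enum 'I_n].
have QU (A B : {set 'I_n}) : i \notin A -> i \notin B -> i \notin A :|: B.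
  by rewrite inE negb_or => -> ->.
have R_avoid : ~~ (ksp [set i] <= R)%VS.
  apply/negP => /addv_idPl kR; have := fd _ i0.
  rewrite /h kR big_set1 /c addnCA leqNgt -[X in X < _]addn0 ltn_add2l.
  by rewrite addn_gt0 di.
have sUs : size Us <= #|F| by rewrite size_map size_enum_ord ltnW.
(* If the messages of [i] added nothing to a tight set avoiding [i], joining [i] to it would break
   feasibility, as [0 < d i]. *)
have avoid U : U \in Us -> ~~ (ksp [set i] <= U)%VS.
  case/mapP => u _ ->; case: ifP => // /andP[/andP[H0 /eqP tH] iH].
  apply/negP => kU.
  have U0 : i |: H u != set0 by apply/set0Pn; exists i; rewrite !inE eqxx.
  have := fd _ U0; rewrite big_setU1 //= -addnA tH /h kspU [(ksp [set i] + _)%VS]addvC addvA.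
  rewrite (addv_idPl kU) leqNgt -[X in X < _]add0n ltn_add2r.
  by rewrite di.
have [v vi vU] := vspace_avoid sUs avoid.
have vR : v \notin R.
  have iUs : (if tight h c d (H i) && (i \notin H i) then (R + ksp (H i))%VS else R) \in Us.
    by apply: map_f; rewrite mem_enum.
  apply: contra (vU _ iUs) => vR; case: ifP => // _.
  by apply: subvP vR; apply: addvSl.
have v_tight S : tight h c d S -> i \notin S -> v \notin (R + ksp S)%VS.
  move=> tS iS; have /andP[/set0Pn[u uS] _] := tS.
  have [tH iH SH] := tight_hullP (ksp_submodular R) fd QU tS iS uS.
  have uUs : (if tight h c d (H u) && (i \notin H u) then (R + ksp (H u))%VS else R) \in Us.
    by apply: map_f; rewrite mem_enum.
  apply: contra (vU _ uUs); rewrite /H tH iH /=.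
  by apply: subvP; rewrite addvS // kspS.
pose R1 := (R + <[v]>)%VS; pose d1 j := d j - (j == i).
have dimR1 : \dim R1 = (\dim R).+1 by rewrite /R1 dim_addv_line vR addn1.
have sum1 (S : {set 'I_n}) : \sum_(j in S) d1 j + (i \in S) = \sum_(j in S) d j.
  have [iS|iS] := boolP (i \in S).
    rewrite !(bigD1 i iS) /= /d1 eqxx addnAC subnK //; congr (_ + _).
    by apply: eq_bigr => j /andP[_ /negbTE ->]; rewrite subn0.
  rewrite addn0; apply: eq_bigr => j jS; rewrite /d1.
  by case: eqP => [ji|_]; rewrite ?subn0 //; rewrite -ji jS in iS.
have dm1 : \sum_j d1 j = m.
  have sumT (f : 'I_n -> nat) : \sum_(j in setT) f j = \sum_j f j.
    by apply: eq_bigl => j; rewrite inE.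
  by have := sum1 setT; rewrite !sumT inE dm addn1 => -[].
(* [R1] raises the demand by one: sets containing [i] regain it from [d1], tight sets avoiding [i]
   gain the dimension of [v], and the others have slack. *)
have fd1 : feasible (fun S => \dim (R1 + ksp S)) (\dim R1 + tau) d1.
  move=> S S0; rewrite dimR1 addSn addnS -/c.
  have R1S : (R1 + ksp S = (R + ksp S) + <[v]>)%VS by rewrite /R1 -addvA [(<[v]> + _)%VS]addvC addvA.
  have hS := fd S S0; rewrite -(sum1 S) in hS.
  have [iS|iS] := boolP (i \in S).
    rewrite iS addn1 addSn in hS; apply: leq_trans hS _.
    by rewrite R1S dimvS // addvSl.
  rewrite (negbTE iS) addn0 in hS.
  rewrite R1S dim_addv_line.
  have [tS|ntS] := boolP (tight h c d S).
    by rewrite (v_tight S tS iS) addn1 ltnS.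
  apply: leq_trans (leq_addr _ _); rewrite ltn_neqAle hS andbT.
  by move: ntS; rewrite /tight S0 /= -(sum1 S) (negbTE iS) addn0.
have vE : v \in coordsp F E' by apply: subvP vi; apply: fspanS; apply: known_sub.
have R1E : (R1 <= coordsp F E')%VS by rewrite subv_add RE -memvE.
have [|L [sL Li dL LE Lj]] := IH d1 R1 dm1 fd1 R1E.
  by rewrite dimR1 -dimR /c !addSn addnS.
exists ((i, v) :: L); rewrite /= span_cons addvA -/R1; split=> //.
- by rewrite sL.
- move=> x; rewrite inE => /orP[/eqP->|]; last exact: Li.
  apply: subvP vi; apply: fspanS; apply/subsetP => e /knownP[_ [j]].
  by rewrite inE => /eqP ->.
- by rewrite dL dimR1 addSnnS.
Qed.

Lemma linear_achievable : linear_generates F I tau (#|E'| - tau).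
Proof.
have [d fd dm] := transmission_counts.
have tE := tau_le_card.
have [|||L [sL LI dL LE Lj]] := @transmissions (#|E'| - tau) d 0%VS dm.
- by move=> S S0; rewrite add0v dimv0 add0n dim_coordsp fd.
- exact: sub0v.
- by rewrite dimv0 add0n addnC subnK.
set t := #|E'| - tau in sL dL *.
pose R := <<map snd L>>%VS; rewrite add0v -/R in LE.
have dimR : \dim R = t by move: dL; rewrite add0v dimv0.
have RE j : (coordsp F E' <= R + ksp [set j])%VS by have := Lj j; rewrite add0v.
(* The key consists of the dot products with a basis of a complement of the transmitted span;
   together with the transmitted vectors it is free, which makes the joint counts exact. *)
pose B := vbasis (coordsp F E' :\: R).
have dimB : \dim (coordsp F E' :\: R) = tau.
  have := dimv_cap_compl (coordsp F E') R.
  rewrite (capv_idPr LE) dimR dim_coordsp /t -{2}(subnK tE) => /eqP.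
  by rewrite eqn_add2l => /eqP.
have sB : size B == tau by rewrite size_tuple dimB.
have sL2 : size L == t by rewrite sL.
pose BT : tau.-tuple V := Tuple sB; pose LL : t.-tuple ('I_n * V) := Tuple sL2.
pose LT : t.-tuple V := map_tuple snd LL.
have LTE r : tnth LT r = (tnth LL r).2 by exact: tnth_map.
have freeB : free BT.
  by rewrite /free /= size_tuple; have /andP[/eqP-> _] := vbasisP (coordsp F E' :\: R).
have freeL : free LT by rewrite /free size_tuple /= -/R dimR.
have freeBL : free (cat_tuple BT LT).
  rewrite /free size_tuple /= span_cat -/R.
  have /andP[/eqP-> _] := vbasisP (coordsp F E' :\: R).
  by rewrite addv_diff (addv_idPl LE) dim_coordsp addnC subnK.
exists (fun r => (tnth LL r).1), (fun r => (tnth LL r).2); split=> [r i|].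
  have /coordspP/(_ i) := LI _ (mem_tnth r LL).
  by case: (i \in I _) => // ->; rewrite ?eqxx.
pose K (x : {ffun M -> F}) := [ffun i => dot (tnth BT i) x].
pose T : {ffun M -> F} -> {ffun 'I_t -> F} :=
  linear_transcript (fun r i => (tnth LL r).2 i).
have TE x : T x = [ffun r => dot (tnth LT r) x].
  by apply/ffunP => r; rewrite !ffunE LTE.
have eq_dots m (X : m.-tuple V) (w : {ffun 'I_m -> F}) x :
    ([ffun r => dot (tnth X r) x] == w) = [forall r, dot (tnth X r) x == w r].
  apply/eqP/forallP => [<- r|H]; first by rewrite ffunE.
  by apply/ffunP => r; rewrite ffunE; apply/eqP.
have cardK k : #|[set x | K x == k]| * #|F| ^ tau = #|F| ^ #|M|.
  rewrite -(card_solutions k freeB); congr (_ * _).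
  by apply: eq_card => x; rewrite !inE eq_dots.
rewrite -/T; exists K; split=> [j x y xy Txy|//|k w].
  apply/ffunP => r; rewrite !ffunE; apply/eqP; rewrite -subr_eq0 -dotBr.
  (* Modulo the transmitted span, each key vector involves only messages known to [j]. *)
  have : tnth BT r \in (R + ksp [set j])%VS.
    apply: subvP (RE j) _ _; apply: subvP (diffvSl _ R) _ _.
    by apply: vbasis_mem; apply: mem_tnth.
  case/memv_addP => a aR [b bj ->]; rewrite dotDl.
  rewrite (dot_span (X := LT)) ?add0r //; last first.
    move=> a' /tnthP[r' ->]; rewrite dotBr; apply/eqP; rewrite subr_eq0.
    have /ffunP/(_ r') := etrans (esym (TE x)) (etrans Txy (TE y)).
    by rewrite !ffunE => ->.
  apply/eqP; rewrite /dot big1 // => e _; rewrite ffunE.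
  have [ej|ej] := boolP (e \in I j); first by rewrite (xy e ej) subrr mulr0.
  rewrite (coordspP _ _ bj) ?mul0r //; apply: contra ej => /knownP[_ [j']].
  by rewrite inE => /eqP ->.
have cardT : #|[set x | T x == w]| * #|F| ^ t = #|F| ^ #|M|.
  rewrite -(card_solutions w freeL); congr (_ * _).
  by apply: eq_card => x; rewrite [LHS]inE [RHS]inE TE eq_dots.
pose kw (i : 'I_(tau + t)) : F := match split i with inl a => k a | inr b => w b end.
have cardKT : #|[set x | (K x == k) && (T x == w)]|
    * #|F| ^ (tau + t) = #|F| ^ #|M|.
  rewrite -(card_solutions kw freeBL); congr (_ * _).
  apply: eq_card => x; rewrite !inE TE !eq_dots; apply/andP/forallP => [[/forallP xB /forallP xL] i|H].
    rewrite /kw; case: splitP => a ai.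
      by rewrite (_ : i = lshift t a) ?tnth_lshift //; apply: val_inj.
    by rewrite (_ : i = rshift tau a) ?tnth_rshift //; apply: val_inj.
  split; apply/forallP => a.
    have := H (lshift t a); rewrite /kw tnth_lshift; case: splitP => b /= ab.
      by rewrite (val_inj ab : a = b).
    by have := ltn_ord a; rewrite ab ltnNge leq_addr.
  have := H (rshift tau a); rewrite /kw tnth_rshift; case: splitP => b /= ab.
    by have := ltn_ord b; rewrite -ab ltnNge leq_addr.
  by rewrite (val_inj (addnI ab) : a = b).
have q0 m : 0 < #|F| ^ m by rewrite expn_gt0 (ltnW (finNzRing_gt1 F)).
apply/eqP; rewrite -(eqn_pmul2r (q0 (tau + t))) mulnAC cardKT expnD mulnACA cardK cardT.
by rewrite eqxx.
Qed.

End Achievability.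

Theorem theorem11 (n : nat) (M : finType) (F : finFieldType)
    (I : 'I_n -> {set M}) (tau : nat) :
  (2 <= n)%N -> (n < #|F|)%N ->
  \bigcup_(j : 'I_n) I j = [set: M] ->
  (1 <= tau)%N ->
  protocol_generates F I tau ->
  exists rho : nat,
    [/\ is_min (rho_pred I tau) rho, (tau <= rho)%N
      & is_min (linear_generates F I tau) (rho - tau)%N].
Proof.
move=> n1 nF cover _ [t [s [T [causalT keysT]]]].
have n0 := ltnW n1.
have pcT := keys_partition_connected n0 cover causalT keysT.
have nonempty (E' : {set M}) e : e \in E' -> clients I e != set0.
  move=> _; have : e \in \bigcup_j I j by rewrite cover inE.
  by case/bigcupP => j _ ej; apply/set0Pn; exists j; rewrite inE.
(* [partition_connected] is boolean, so a least cardinality can be extracted; [setT] qualifies by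
   [pcT]. *)
pose P k := [exists E' : {set M}, partition_connected I tau E' && (#|E'| == k)].
have exP : exists k, P k.
  by exists #|[set: M]|; apply/existsP; exists setT; rewrite pcT eqxx.
case: (ex_minnP exP) => _ /existsP[E' /andP[pcE /eqP <-]] Emin.
have min_card (E'' : {set M}) : partition_connected I tau E'' -> #|E'| <= #|E''|.
  by move=> pc; apply: Emin; apply/existsP; exists E''; rewrite pc eqxx.
exists #|E'|; split.
- split=> [|_ [E'' [inh <-]]].
    by exists E'; split=> //; apply: partition_connected_inherently.
  by apply/min_card/inherently_partition_connected => //; apply: nonempty.
- exact: tau_le_card pcE.
split=> [|k /(linear_lower_bound n0)[E'' [pc leE]]].
  exact: linear_achievable.
by rewrite leq_subLR addnC (leq_trans (min_card _ pc)).
Qed.
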